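(* Let $R$ be an $F$-finite regular domain of characteristic $p>0$ and let $f\in R$ be nonzero. For every $e\geq 1$, the roots of the Bernstein-Sato polynomial $b_f^{(e)}(s)\in\mathbf{Q}[s]$ are simple, and they are given by the rational numbers $$\frac{\lceil p^e\lambda\rceil-1}{p^e},$$ where $\lambda$ varies over the $F$-jumping exponents of $f$ in $(0,1]$.
   Context: $R$ is $F$-finite if the Frobenius map $u\mapsto u^p$ on $R$ is finite; $\lceil u\rceil$ is the smallest integer $\geq u$. Differential operators: for $e\ge 0$ let $D_R^e=\mathrm{End}_{R^{p^e}}(R)$ and $D_{R[t]}^e=\mathrm{End}_{R[t]^{p^e}}(R[t])$; the action of an operator $P$ on a ring element $h$ is denoted $P\bullet h$. $D_R^e$ is viewed inside $D_{R[t]}^e$ by acting on coefficients. The operators $\partial_t^{[m]}$ are $R$-linear with $\partial_t^{[m]}\bullet t^r=\binom{r}{m}t^{r-m}$ ($\binom{r}{m}=0$ if $r<m$), and $\partial_t^{[m]}\in D_{R[t]}^e$ if $m<p^e$. Put $\theta_m=\partial_t^{[m]}t^m$ (composition: multiply by $t^m$, then apply $\partial_t^{[m]}$). The module $B_f$: $B_f=R[t]_{f-t}/R[t]$. Every element of $R[t]_{f-t}$ can be written $h/(f-t)^{Np^e}$ with $h\in R[t]$, $N\ge 0$, and $P\in D_{R[t]}^e$ acts by $P\cdot \frac{h}{(f-t)^{Np^e}}=\frac{P\bullet h}{(f-t)^{Np^e}}$; this induces a left $D_{R[t]}^e$-module structure on $B_f$. Let $\delta\in B_f$ be the class of $\frac{1}{f-t}$.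 Put $M_f^e=D_R^e[\theta_1,\theta_p,\ldots,\theta_{p^{e-1}}]\cdot\delta\subseteq B_f$, where $D_R^e[\theta_1,\ldots,\theta_{p^{e-1}}]$ is the subring of $D_{R[t]}^e$ generated by $D_R^e$ and these operators. One has $tM_f^e\subseteq M_f^e$, and the $\theta_{p^{i}}$, $0\le i\le e-1$, act on $M_f^e/tM_f^e$. Bernstein-Sato polynomials: $\Gamma_f^e\subseteq\{0,1,\ldots,p-1\}^e$ is the set of $(i_1,\ldots,i_e)$ such that there is a nonzero $u\in M_f^e/tM_f^e$ with $(\theta_{p^{\ell-1}}+i_\ell)u=0$ for all $1\le\ell\le e$. Then $$b_f^{(e)}(s)=\prod_{(i_1,\ldots,i_e)\in\Gamma_f^e}\left(s-\left(\frac{i_e}{p}+\frac{i_{e-1}}{p^2}+\cdots+\frac{i_1}{p^e}\right)\right).$$ Test ideals: for an ideal $J$ of $R$, $J^{[p^e]}$ is the ideal generated by $\{u^{p^e}: u\in J\}$. For an ideal $\mathfrak{b}$ of $R$, $\mathfrak{b}^{[1/p^e]}$ is the unique smallest ideal $J$ with $\mathfrak{b}\subseteq J^{[p^e]}$ (it exists). For real $\lambda\ge 0$ the ideals $\left(f^{\lceil\lambda p^e\rceil}\right)^{[1/p^e]}$ increase with $e$, and the test ideal $\tau(f^\lambda)$ is their common value for $e\gg 0$. A positive real $\lambda$ is an $F$-jumping exponent of $f$ if $\tau(f^\lambda)\ne\tau(f^{\lambda-\varepsilon})$ for every $\varepsilon$ with $0<\varepsilon\le\lambda$. *)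

(* Defs.v *)
From HB Require Import structures.
From mathcomp Require Import all_boot all_order all_algebra fraction.
From mathcomp Require Import generic_quotient ring_quotient.
From mathcomp Require Import all_classical all_reals all_analysis.

Set Implicit Arguments.
Unset Strict Implicit.
Unset Printing Implicit Defensive.

Import Order.TTheory GRing.Theory Num.Theory.

Local Open Scope classical_set_scope.
Local Open Scope quotient_scope.
Local Open Scope ring_scope.

Local Notation "x %:F" := (@tofrac _ x).

Section Ideals.
Variable A : comNzRingType.
Implicit Types I J P : set A.

(* MathComp's [idealr] only covers proper decidable ideals. *)
Definition is_ideal I : Prop :=
  I 0 /\ forall a x y, I x -> I y -> I (a * x + y).

Definition ideal_gen (G : set A) : set A := smallest is_ideal G.

Definition prime_ideal P : Prop :=
  [/\ is_ideal P, ~ P 1 & forall x y, P (x * y) -> P x \/ P y].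

Definition maximal_ideal I : Prop :=
  [/\ is_ideal I, ~ I 1 & forall J, is_ideal J -> ~ J 1 -> I `<=` J -> J = I].

Definition noetherian : Prop :=
  forall I, is_ideal I -> exists s : seq A, I = ideal_gen [set` s].

Definition has_prime_chain (d : nat) : Prop :=
  exists c : 'I_d.+1 -> set A,
    (forall i, prime_ideal (c i)) /\
    (forall i j : 'I_d.+1, (i < j)%N -> c i `<` c j).

Definition krull_dim_eq (d : nat) : Prop :=
  has_prime_chain d /\ forall n, has_prime_chain n -> (n <= d)%N.

Definition regular_local_ring : Prop :=
  noetherian /\
  exists m : set A,
    [/\ maximal_ideal m, forall m', maximal_ideal m' -> m' = m &
        exists s : seq A, m = ideal_gen [set` s] /\ krull_dim_eq (size s)].

End Ideals.

Section Localization.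
Variables (A : idomainType) (S : mulrClosed A).

Definition loc_pred : {pred {fraction A}} :=
  fun x => `[< exists a s, s \in S /\ x = a%:F / s%:F >].

Lemma loc_predP x :
  reflect (exists a s, s \in S /\ x = a%:F / s%:F) (x \in loc_pred).
Proof. exact: asboolP. Qed.

Lemma loc_subring : subring_closed loc_pred.
Proof.
split.
- by apply/loc_predP; exists 1, 1; rewrite rpred1 tofrac1 divr1.
- move=> x y /loc_predP [a [s [Ss ->]]] /loc_predP [b [t [St ->]]].
  apply/loc_predP.
  have [->|s0] := eqVneq s 0.
    by exists (- b), t; split=> //; rewrite tofrac0 invr0 mulr0 sub0r tofracN mulNr.
  have [->|t0] := eqVneq t 0.
    by exists a, s; split=> //; rewrite tofrac0 invr0 mulr0 subr0.
  exists (a * t - b * s), (s * t); split; first exact: rpredM.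
  by rewrite tofracB !tofracM -mulNr addf_div ?tofrac_eq0 // mulNr.
- move=> x y /loc_predP [a [s [Ss ->]]] /loc_predP [b [t [St ->]]].
  apply/loc_predP; exists (a * b), (s * t); split; first exact: rpredM.
  by rewrite !tofracM mulf_div.
Qed.

HB.instance Definition _ := GRing.isSubringClosed.Build {fraction A} loc_pred
  loc_subring.

Record loc : Type := Loc { loc_val :> {fraction A}; _ : loc_val \in loc_pred }.

HB.instance Definition _ := [isSub for loc_val].
HB.instance Definition _ := [Choice of loc by <:].
HB.instance Definition _ := [SubChoice_isSubComNzRing of loc by <:].

Lemma loc_fracP a s : s \in S -> a%:F / s%:F \in loc_pred.
Proof. by move=> Ss; apply/loc_predP; exists a, s. Qed.

Definition loc_frac a s (Ss : s \in S) : loc := Loc (loc_fracP a Ss).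

End Localization.

Section PrimeComplement.
Variables (A : comNzRingType) (P : set A) (hP : prime_ideal P).

Definition prime_compl of prime_ideal P : {pred A} := fun x => x \notin P.

Lemma prime_compl_closed : mulr_closed (prime_compl hP).
Proof.
have [_ P1 PM] := hP; split; first by apply/negP => /set_mem.
move=> x y /negP Px /negP Py; apply/negP => /set_mem /PM.
by case=> /mem_set.
Qed.

HB.instance Definition _ := GRing.isMulClosed.Build A (prime_compl hP)
  prime_compl_closed.

End PrimeComplement.

Definition regular_ring (A : idomainType) : Prop :=
  noetherian A /\
  forall (P : set A) (hP : prime_ideal P),
    regular_local_ring (loc (prime_compl hP)).

Definition F_finite (p : nat) (A : comNzRingType) : Prop :=
  exists (n : nat) (g : 'I_n -> A),
    forall x, exists c : 'I_n -> A, x = \sum_(i < n) c i ^+ p * g i.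

Section DiffOp.
Variables (p e : nat).

Definition diff_op (A : comNzRingType) (P : A -> A) : Prop :=
  zmod_morphism P /\ forall a x, P (a ^+ (p ^ e) * x) = a ^+ (p ^ e) * P x.

Variable R : comNzRingType.

Definition theta (m : nat) (h : {poly R}) : {poly R} := ('X^m * h)^`N(m).

Definition op_subring (S : set ({poly R} -> {poly R})) : Prop :=
  [/\ S id,
      forall P Q, S P -> S Q -> S (P \- Q) &
      forall P Q, S P -> S Q -> S (P \o Q)].

(* Here [map_poly P] is [P] acting on coefficients. *)
Definition DR_theta : set ({poly R} -> {poly R}) :=
  smallest op_subring
    ([set map_poly P | P in @diff_op R] `|`
     [set theta (p ^ i) | i in [set i | (i < e)%N]]).

End DiffOp.

Section Bf.
Variables (R : idomainType) (f : R).

Definition f_sub_t : {poly R} := f%:P - 'X.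

Definition powers : {pred {poly R}} := fun x => `[< exists n, x = f_sub_t ^+ n >].

Lemma powers_exp n : f_sub_t ^+ n \in powers.
Proof. by apply/asboolP; exists n. Qed.

Lemma powers_closed : mulr_closed powers.
Proof.
split; first exact: (powers_exp 0).
move=> x y /asboolP [n ->] /asboolP [m ->].
by rewrite -exprD powers_exp.
Qed.

HB.instance Definition _ := GRing.isMulClosed.Build {poly R} powers powers_closed.

Definition Rt_loc : comNzRingType := loc powers.

Definition poly_pred : {pred Rt_loc} :=
  fun x => `[< exists h : {poly R}, val x = h%:F >].

Lemma poly_pred_closed : zmod_closed poly_pred.
Proof.
split; first by apply/asboolP; exists 0; rewrite tofrac0.
move=> x y /asboolP [a xa] /asboolP [b yb]; apply/asboolP.
by exists (a - b); rewrite raddfB /= xa yb tofracB.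
Qed.

HB.instance Definition _ := GRing.isZmodClosed.Build Rt_loc poly_pred
  poly_pred_closed.

Definition Bf : zmodType := {ideal_quot poly_pred}.

(* The class of h / (f - t)^n. *)
Definition Bcls (h : {poly R}) (n : nat) : Bf :=
  \pi_{ideal_quot poly_pred} (loc_frac h (powers_exp n) : Rt_loc).

Definition delta : Bf := Bcls 1 1.

Definition Bmul (a : {poly R}) (u : Bf) : Bf :=
  \pi_{ideal_quot poly_pred}
    ((loc_frac a (powers_exp 0) : Rt_loc) * repr (u : {ideal_quot poly_pred})).

(* For P in D^e_{R[t]} the action does not depend on the representative h,
   see [BactE]. *)
Definition Bact (p e : nat) (P : {poly R} -> {poly R}) (u : Bf) : Bf :=
  xget 0 [set v | exists h N,
    u = Bcls h (N * p ^ e) /\ v = Bcls (P h) (N * p ^ e)].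

Definition Mf (p e : nat) : set Bf :=
  [set Bact p e P delta | P in DR_theta p e (R := R)].

Definition tMf (p e : nat) : set Bf := [set Bmul 'X u | u in Mf p e].

(* The coordinate i_l of the usual indexing 1 <= l <= e is [i (l - 1)]. *)
Definition Gamma (p e : nat) : set {ffun 'I_e -> 'I_p} :=
  [set i : {ffun 'I_e -> 'I_p} | exists u : Bf,
    [/\ Mf p e u, ~ tMf p e u &
        forall l : 'I_e, tMf p e (Bact p e (theta (p ^ l)) u + u *+ i l)]].
Arguments Gamma p e : clear implicits.

Definition BS_poly (p e : nat) : {poly rat} :=
  \prod_(i in Gamma p e)
    ('X - (\sum_(l < e) (i l)%:R / (p ^ (e - l))%:R)%:P).

Lemma f_sub_t_neq0 : f_sub_t != 0.
Proof.
by rewrite /f_sub_t -opprB oppr_eq0 polyXsubC_eq0.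
Qed.

Lemma Bcls_eq h n h' n' :
  Bcls h n = Bcls h' n' <->
  exists r, h * f_sub_t ^+ n' - h' * f_sub_t ^+ n = r * f_sub_t ^+ (n + n').
Proof.
have g0 k : (f_sub_t ^+ k)%:F != 0 by rewrite tofrac_eq0 expf_neq0 ?f_sub_t_neq0.
have key r : (h%:F / (f_sub_t ^+ n)%:F - h'%:F / (f_sub_t ^+ n')%:F = r%:F) <->
   (h * f_sub_t ^+ n' - h' * f_sub_t ^+ n = r * f_sub_t ^+ (n + n')).
  rewrite -mulNr addf_div // exprD; split.
    move=> /(congr1 ( *%R^~ ((f_sub_t ^+ n)%:F * (f_sub_t ^+ n')%:F))).
    rewrite divfK ?mulf_neq0 // => E; apply/eqP; rewrite -tofrac_eq; apply/eqP.
    by rewrite tofracB !tofracM -mulNr E.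
  move=> /(congr1 (@tofrac _)); rewrite tofracB !tofracM -mulNr => ->.
  by rewrite mulfK ?mulf_neq0.
have -> : Bcls h n = Bcls h' n' <->
  (loc_frac h (powers_exp n) : Rt_loc) - loc_frac h' (powers_exp n') \in poly_pred.
  rewrite /Bcls; split.
    by move/eqP; rewrite -(Quotient.idealrBE poly_pred).
  by move=> H; apply/eqP; rewrite -(Quotient.idealrBE poly_pred).
split; first by move/asboolP => [r]; rewrite raddfB /= => /key; exists r.
by move=> [r /key E]; apply/asboolP; exists r; rewrite raddfB.
Qed.

Lemma BactE p e P h N : (0 < p)%N -> diff_op p e P ->
  Bact p e P (Bcls h (N * p ^ e)) = Bcls (P h) (N * p ^ e).
Proof.
move=> p0 [PB PM]; apply: xget_unique; first by exists h, N.
move=> v [h' [N' [/Bcls_eq [r E] ->]]]; apply/esym/Bcls_eq; exists (P r).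
have PMg x k : P (x * f_sub_t ^+ (k * p ^ e)) = P x * f_sub_t ^+ (k * p ^ e).
  by rewrite mulrC exprM PM mulrC.
by rewrite -!PMg -PB E -mulnDl PMg.
Qed.

Lemma BmulE a h n : Bmul a (Bcls h n) = Bcls (a * h) n.
Proof.
rewrite /Bmul /Bcls.
set x : Rt_loc := loc_frac h _.
have /asboolP [r E] : repr (\pi_{ideal_quot poly_pred} x) - x \in poly_pred.
  by rewrite Quotient.idealrBE reprK.
apply/eqP; rewrite -(Quotient.idealrBE poly_pred); apply/asboolP.
exists (a * r); move: E; rewrite !raddfB /= => E.
by rewrite expr0 tofrac1 divr1 !tofracM -mulrA -mulrBr E.
Qed.

End Bf.

Section TestIdeals.
Variables (R : comNzRingType) (p : nat).

Definition frob_power (J : set R) (e : nat) : set R :=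
  ideal_gen [set u ^+ (p ^ e) | u in J].

Definition is_frob_root (b : set R) (e : nat) (J : set R) : Prop :=
  [/\ is_ideal J, b `<=` frob_power J e &
      forall J', is_ideal J' -> b `<=` frob_power J' e -> J `<=` J'].

Definition frob_root (b : set R) (e : nat) : set R :=
  xget set0 (is_frob_root b e).

Variables (K : realType) (f : R).

Definition test_ideal_approx (lam : K) (e : nat) : set R :=
  frob_root (ideal_gen [set f ^+ `|Num.ceil (lam * (p ^ e)%:R)|%N]) e.

Definition test_ideal (lam : K) : set R :=
  xget set0 [set J | \forall e \near \oo, test_ideal_approx lam e = J].

Definition F_jumping_exponent (lam : K) : Prop :=
  0 < lam /\
  forall eps, 0 < eps -> eps <= lam -> test_ideal lam <> test_ideal (lam - eps).

End TestIdeals.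

(* Main.v *)
(* Put q = p^e.  Regularity and F-finiteness make R projective over R^q, so there
   are R^q-linear forms phi_t^q and elements g_t with x = sum_t phi_t(x)^q g_t.
   Locally this is freeness of R over R^p: if the regular parameters x_1, ..., x_d
   generate a chain of d + 1 distinct primes (Krull's principal ideal theorem),
   then a basis of R/(x_1, ..., x_(i+1)) over its p-th powers, multiplied by the
   powers x_(i+1)^k with k < p, is a basis of R/(x_1, ..., x_i).

   With such forms, the ideals D_R^e . f^k and ((f^k)^[1/q])^[q] agree.  As
   delta = sum_(j<q) f^(q-1-j) t^j / (f-t)^q and theta_(p^l) multiplies t^j by
   floor(j/p^l) + 1, the module M_f^e is the direct sum of the
   (D_R^e . f^(q-1-j)) t^j / (f-t)^q for j < q, and t M_f^e is the direct sum of
   the (D_R^e . f^(q-j)) t^j / (f-t)^q.  Hence the roots of b_f^(e) are the k/q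
   with k < q and (f^k)^[1/q] <> (f^(k+1))^[1/q].  Finally
   (f^k)^[1/q] = tau(f^(k/q)), and tau is right continuous, so these k are the
   ones for which there is a jumping exponent in (k/q, (k+1)/q]. *)
Require Import Defs.
From HB Require Import structures.
From mathcomp Require Import all_boot all_order all_algebra fraction.
From mathcomp Require Import generic_quotient ring_quotient.
From mathcomp Require Import all_classical all_reals all_analysis.
From mathcomp Require Import ring zify.

Set Implicit Arguments.
Unset Strict Implicit.
Unset Printing Implicit Defensive.

Import Order.TTheory GRing.Theory Num.Theory.

Local Open Scope ring_scope.
Local Open Scope classical_set_scope.

(** * Ideals and saturation *)

(** Regularity is given by Krull dimension, while the lifting of bases needs the partial ideals
    (x_1, ..., x_i) to be prime. A prime chain as long as the list of generators of the maximal
    ideal leaves no slack: pushing it through the generators one at a time and comparing ideals by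
    Nakayama's lemma forces this primality. Lifting generators modulo x uses Nakayama's lemma again,
    now for the action a.v = a^p v, under which R is a finite module.

    The summands of M_f^e separate because theta_(p^l) has its eigenvalues in F_p: by Fermat, 1 -
    (theta_(p^l) - c)^(p-1) projects onto the eigenvalue c. The exponent q-1-j matters as the base-p
    complement of j: its digits are, modulo p, the negatives of the eigenvalues on t^j, which is the
    sign convention of [Gamma]. Right continuity of tau holds because a nonzero f lies in all
    Frobenius powers of an ideal only if this is the unit ideal. *)

Section IdealTheory.
Variable A : comNzRingType.
Implicit Types (I J P Q N W : set A) (G : set A).

Lemma ideal0 I : is_ideal I -> I 0.
Proof. by case. Qed.

Lemma idealD I x y : is_ideal I -> I x -> I y -> I (x + y).
Proof. by move=> [_ +] Ix Iy => /(_ 1 _ _ Ix Iy); rewrite mul1r. Qed.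

Lemma ideal_mull I a x : is_ideal I -> I x -> I (a * x).
Proof. by move=> [I0 +] Ix => /(_ a _ _ Ix I0); rewrite addr0. Qed.

Lemma ideal_mulr I a x : is_ideal I -> I x -> I (x * a).
Proof. by rewrite mulrC; exact: ideal_mull. Qed.

Lemma idealN I x : is_ideal I -> I x -> I (- x).
Proof. by rewrite -mulN1r; exact: ideal_mull. Qed.

Lemma idealB I x y : is_ideal I -> I x -> I y -> I (x - y).
Proof. by move=> hI Ix Iy; apply: idealD => //; exact: idealN. Qed.

Lemma idealBK I x y : is_ideal I -> I (x - y) -> I y -> I x.
Proof. by move=> hI h Iy; rewrite -(subrK y x); exact: idealD. Qed.

Lemma idealX I x n : is_ideal I -> (0 < n)%N -> I x -> I (x ^+ n).
Proof. by case: n => // n hI _ Ix; rewrite exprS; exact: ideal_mulr. Qed.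

Lemma ideal_sum I (T : Type) (r : seq T) (D : pred T) (F : T -> A) :
  is_ideal I -> (forall i, D i -> I (F i)) -> I (\sum_(i <- r | D i) F i).
Proof.
move=> hI IF; elim/big_rec: _ => [|i x /IF]; first exact: ideal0.
exact: idealD.
Qed.

Lemma ideal_gen_ideal G : is_ideal (ideal_gen G).
Proof.
split; first by move=> I [[]].
by move=> a x y Gx Gy I [hI GI]; apply: hI.2; [exact: Gx|exact: Gy].
Qed.

Lemma sub_ideal_gen G : G `<=` ideal_gen G.
Proof. by move=> x Gx I [_]; apply. Qed.

Lemma ideal_gen_sub G I : is_ideal I -> G `<=` I -> ideal_gen G `<=` I.
Proof. by move=> hI GI x; apply. Qed.

Lemma prime_is_ideal P : prime_ideal P -> is_ideal P.
Proof. by case. Qed.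

Lemma prime_exp P x n : prime_ideal P -> P (x ^+ n) -> P x.
Proof.
by case=> _ P1 PM; elim: n => [|n IHn]; rewrite ?expr0 ?exprS // => /PM[|/IHn].
Qed.

Lemma prime_cancel P x y : prime_ideal P -> ~ P x -> P (x * y) -> P y.
Proof. by case=> _ _ PM nPx /PM[]. Qed.

Lemma prime_complM P x y : prime_ideal P -> ~ P x -> ~ P y -> ~ P (x * y).
Proof. by case=> _ _ PM nPx nPy /PM[]. Qed.

Definition add_elt I x : set A := [set u | exists2 i, I i & exists r, u = i + r * x].

Lemma add_elt_ideal I x : is_ideal I -> is_ideal (add_elt I x).
Proof.
move=> hI; split; first by exists 0; [exact: ideal0|exists 0; rewrite mul0r addr0].
move=> a _ _ [i Ii [r ->]] [j Ij [t ->]]; exists (a * i + j); first exact: hI.2.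
by exists (a * r + t); rewrite mulrDr mulrDl mulrA addrACA.
Qed.

Lemma sub_add_elt I x : I `<=` add_elt I x.
Proof. by move=> i Ii; exists i => //; exists 0; rewrite mul0r addr0. Qed.

Lemma add_elt_id I x : is_ideal I -> add_elt I x x.
Proof. by move=> hI; exists 0; [exact: ideal0|exists 1; rewrite mul1r add0r]. Qed.

Lemma add_elt_sub I J x : is_ideal J -> I `<=` J -> J x -> add_elt I x `<=` J.
Proof.
by move=> hJ IJ Jx _ [i Ii [r ->]]; apply: idealD => //; [exact: IJ|exact: ideal_mull].
Qed.

(* The contraction to [A] of the extension of [I] to the localization at [N]. *)
Definition sat N I : set A := [set u | exists2 s, ~ N s & I (s * u)].

Definition saturated N I := forall s u, ~ N s -> I (s * u) -> I u.

Lemma sat_ideal N I : prime_ideal N -> is_ideal I -> is_ideal (sat N I).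
Proof.
move=> hN hI; split.
  by exists 1; [case: hN|rewrite mulr0; exact: ideal0].
move=> a x y [s Ns Isx] [t Nt Ity]; exists (s * t); first exact: prime_complM.
have -> : s * t * (a * x + y) = (t * a) * (s * x) + s * (t * y) by ring.
exact: hI.2 (ideal_mull _ hI Ity).
Qed.

Lemma sub_sat N I : prime_ideal N -> I `<=` sat N I.
Proof. by case=> _ N1 _ u Iu; exists 1; rewrite ?mul1r. Qed.

Lemma sat_saturated N I : prime_ideal N -> saturated N (sat N I).
Proof.
move=> hN s u Ns [t Nt Itsu]; exists (t * s); first exact: prime_complM.
by rewrite -mulrA.
Qed.

Lemma sat_subset N I J : I `<=` J -> sat N I `<=` sat N J.
Proof. by move=> IJ u [s Ns /IJ]; exists s. Qed.

Lemma saturated_sub N Q I : Q `<=` N -> saturated Q I -> saturated N I.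
Proof. by move=> QN sI s u Ns; apply: sI => /QN. Qed.

End IdealTheory.

Section Noetherian.
Variable A : comNzRingType.
Hypothesis noethA : noetherian A.
Implicit Types (I J P Q N W : set A).

Lemma noetherian_acc (c : nat -> set A) :
  (forall n, is_ideal (c n)) -> (forall n, c n `<=` c n.+1) ->
  exists n, forall m, (n <= m)%N -> c m = c n.
Proof.
move=> hc cS.
have cle n m : (n <= m)%N -> c n `<=` c m.
  elim: m => [|m IHm]; first by rewrite leqn0 => /eqP->.
  rewrite leq_eqVlt ltnS => /orP[/eqP->//|/IHm h].
  exact: subset_trans (cS m).
pose U := [set u | exists n, c n u].
have hU : is_ideal U.
  split; first by exists 0%N; exact: ideal0.
  move=> a x y [n cnx] [m cmy]; exists (maxn n m).
  by apply: (hc _).2; [apply: (cle n) cnx; exact: leq_maxl|apply: (cle m) cmy; exact: leq_maxr].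
have [s Us] := noethA hU.
have [n hn] : exists n, [set` s] `<=` c n.
  have : [set` s] `<=` U by rewrite Us; exact: sub_ideal_gen.
  elim: (s) => [_|x r IHr sU]; first by exists 0%N => x; rewrite /= in_nil.
  have [n hn] := IHr (fun y ry => sU y (mem_behead (s := x :: r) ry)).
  have [m hm] := sU x (mem_head x r); exists (maxn n m) => y /=.
  rewrite inE => /orP[/eqP->|/hn]; [apply: (cle m) hm; exact: leq_maxr|].
  by apply: cle; exact: leq_maxl.
exists n => m le_nm; apply/seteqP; split; last exact: cle.
move=> u cmu; suff: U `<=` c n by apply; exists m.
by rewrite Us; exact: ideal_gen_sub.
Qed.

Lemma noetherian_max (F : set (set A)) : (exists I, F I) ->
  (forall I, F I -> is_ideal I) ->
  exists2 M, F M & forall J, F J -> M `<=` J -> J = M.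
Proof.
move=> [I0 FI0] Fid; apply: contrapT => noM.
have /choice[g gP] : forall I, exists J, F I -> F J /\ I `<` J.
  move=> I; apply: contrapT => /forallNP h; apply: noM.
  have FI : F I by have /not_implyP[] := h I.
  exists I => // J FJ IJ; apply: contrapT => nJI.
  have /not_implyP[_] := h J; apply; split=> //; split=> // JI; apply: nJI.
  exact/seteqP.
pose c := fun n => iter n g I0.
have Fc n : F (c n) by elim: n => //= n /gP[].
have [n hn] := noetherian_acc (fun n => Fid _ (Fc n))
  (fun n => properW (gP _ (Fc n)).2).
have [_ [_ nsub]] := gP _ (Fc n); apply: nsub.
have E : g (c n) = c n := hn _ (leqnSn n).
by rewrite E.
Qed.

Lemma maximal_prime P : maximal_ideal P -> prime_ideal P.
Proof.
move=> [hP P1 Pmax]; split=> // x y Pxy; apply: contrapT => /not_orP[nPx nPy].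
have /Pmax E : is_ideal (add_elt P x) by exact: add_elt_ideal.
apply: nPx; rewrite -E; [exact: add_elt_id| |exact: sub_add_elt].
case=> i Pi [r e1]; apply: nPy; rewrite -[y]mul1r e1 mulrDl -mulrA.
by apply: idealD => //; [exact: ideal_mulr|exact: ideal_mull].
Qed.

Lemma ideal_sub_maximal I : is_ideal I -> ~ I 1 ->
  exists2 M, maximal_ideal M & I `<=` M.
Proof.
move=> hI I1.
have [||M [hM M1 IM] Mmax] := @noetherian_max [set J | [/\ is_ideal J, ~ J 1 & I `<=` J]].
- by exists I; split.
- by move=> J [].
exists M => //; split=> // J hJ J1 MJ; apply: Mmax => //; split=> //.
exact: subset_trans MJ.
Qed.

End Noetherian.

(** * Nakayama's lemma at a prime, without forming the localization *)

Section Nakayama.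
Variables (A : comNzRingType) (N : set A) (primeN : prime_ideal N).
(* The action need not be multiplication: Frobenius twists are used too. *)
Variable act : A -> A -> A.
Hypothesis actB : forall a, zmod_morphism (act a).
Hypothesis actBl : forall v, zmod_morphism (act^~ v).
Hypothesis actA : forall a b v, act (a * b) v = act a (act b v).
Variable W : set A.
Hypotheses (W0 : W 0) (WB : forall u v, W u -> W v -> W (u - v)).
Hypothesis WA : forall a v, W v -> W (act a v).
Hypothesis Wsat : forall s v, ~ N s -> W (act s v) -> W v.

(** The submodule W + N h_1 + ... + N h_r, by recursion on the generators so that they can be
    eliminated one at a time. *)
Fixpoint residual (hs : seq A) : set A :=
  if hs is h :: hs' then [set v | exists2 c, N c & residual hs' (v - act c h)]
  else W.

Lemma residual0 hs : residual hs 0.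
Proof.
elim: hs => //= h hs IH; exists 0; first exact: ideal0 (prime_is_ideal primeN).
have -> : act 0 h = 0 by have := actBl h 0 0; rewrite !subrr.
by rewrite subrr.
Qed.

Lemma residualB hs u v : residual hs u -> residual hs v -> residual hs (u - v).
Proof.
elim: hs u v => [|h hs IH] u v /=; first exact: WB.
move=> [c Nc hu] [d Nd hv]; exists (c - d); first by apply: idealB => //; exact: prime_is_ideal.
have -> : u - v - act (c - d) h = u - act c h - (v - act d h) by rewrite actBl; ring.
exact: IH.
Qed.

Lemma residualA hs a v : residual hs v -> residual hs (act a v).
Proof.
elim: hs v => [|h hs IH] v /=; first exact: WA.
move=> [c Nc hv]; exists (a * c); first by apply: ideal_mull => //; exact: prime_is_ideal.
by rewrite actA -actB; exact: IH.
Qed.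

Lemma residual_sub hs v : (forall h, h \in hs -> W h) -> residual hs v -> W v.
Proof.
elim: hs v => [|h hs IH] v //= hW [c _ /IH] hv.
have -> : v = (v - act c h) - (0 - act c h) by ring.
apply: WB; first by apply: hv => x hx; apply: hW; rewrite inE hx orbT.
by apply: WB => //; apply/WA/hW; exact: mem_head.
Qed.

Lemma residual_act hs n h : N n -> h \in hs -> residual hs (act n h).
Proof.
move=> Nn; elim: hs => //= h' hs IH; rewrite inE => /orP[/eqP->|/IH rh].
  by exists n => //; rewrite subrr; exact: residual0.
exists 0; first exact: ideal0 (prime_is_ideal primeN).
have -> : act 0 h' = 0 by have := actBl h' 0 0; rewrite !subrr.
by rewrite subr0.
Qed.

Lemma sub_residual hs v : W v -> residual hs v.
Proof.
move=> Wv; elim: hs => //= h hs rv; exists 0.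
  exact: ideal0 (prime_is_ideal primeN).
have -> : act 0 h = 0 by have := actBl h 0 0; rewrite !subrr.
by rewrite subr0.
Qed.

(** If s h lies in W + N h + N hs, then t h lies in W + N hs for some t = s - c outside N.
    Multiplying the other relations by t removes h from them, so induction puts [hs] in W; then t h
    is in W, and [Wsat] cancels t. *)
Lemma nakayama hs :
  (forall h, h \in hs -> exists2 s, ~ N s & residual hs (act s h)) ->
  forall h, h \in hs -> W h.
Proof.
elim: hs => // h hs IH hyp.
have hN := prime_is_ideal primeN.
have [s0 Ns0 [c0 Nc0]] := hyp _ (mem_head h hs).
set t := s0 - c0; rewrite -actBl -/t => th.
have Nt : ~ N t by move=> Nt; apply: Ns0; rewrite -(subrK c0 s0); exact: idealD.
clearbody t.
have hsW : forall h', h' \in hs -> W h'.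
  apply: IH => h' hh'.
  have [|s Ns [c Nc hs']] := hyp h'; first by rewrite inE hh' orbT.
  exists (t * s); first exact: prime_complM.
  have -> : act (t * s) h' = act t (act s h' - act c h) - (act (0 - c) (act t h)).
    rewrite !(actB, actBl) actA -[act t (act c h)]actA -[act c (act t h)]actA.
    have -> : act 0 (act t h) = 0 by have := actBl (act t h) 0 0; rewrite !subrr.
    by rewrite [t * c]mulrC; ring.
  by apply: residualB; exact: residualA.
move=> h'; rewrite inE => /orP[/eqP->|/hsW//].
exact: Wsat Nt (residual_sub hsW th).
Qed.

End Nakayama.

(** The case of multiplication: locally at N, J inside W + NJ implies J inside W. Saturation of W
    stands in for the localization. *)
Lemma nakayama_ideal (A : comNzRingType) (N W J : set A) : noetherian A ->
  prime_ideal N -> is_ideal W -> is_ideal J -> saturated N W ->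
  (forall u, J u -> exists2 s, ~ N s & exists2 w, W w &
     ideal_gen [set x | exists2 n, N n & exists2 r, J r & x = n * r] (s * u - w)) ->
  J `<=` W.
Proof.
move=> noethA hN hW hJ sW hyp; have [hs Jhs] := noethA _ hJ.
have N0 := ideal0 (prime_is_ideal hN).
pose res := residual N *%R W hs.
have mB (a : A) : zmod_morphism ( *%R a) by move=> x y; rewrite mulrBr.
have mBl (x : A) : zmod_morphism ( *%R^~ x) by move=> a b; rewrite /= mulrBl.
have res0 : res 0 by apply: residual0 => //; exact: ideal0.
have resB u v : res u -> res v -> res (u - v).
  by apply: residualB => //; move=> x y; exact: idealB.
have resid : is_ideal res.
  split=> // a x y hx hy; rewrite -[y]opprK; apply: (resB).
    by apply: residualA => //; [move=> b d v; rewrite mulrA|move=> b v; exact: ideal_mull].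
  by rewrite -sub0r; exact: resB.
have Wres w : W w -> res w by exact: sub_residual.
rewrite {1}Jhs; apply: ideal_gen_sub => // h hhs.
apply: (@nakayama _ N hN *%R _ _ _ W _ _ _ _ hs) => //.
- by move=> b d v; rewrite mulrA.
- exact: ideal0.
- by move=> u v; exact: idealB.
- by move=> a v; exact: ideal_mull.
move=> h' hh'; have Jh' : J h' by rewrite Jhs; exact: sub_ideal_gen.
have [s Ns [w Ww Jw]] := hyp _ Jh'; exists s => //.
apply: (idealBK resid _ (Wres _ Ww)).
apply: (ideal_gen_sub resid) Jw.
move=> _ [n Nn [r Jr ->]].
have hn : is_ideal [set r | res (n * r)].
  split=> [|a y z ry rz] /=; first by rewrite mulr0.
  by rewrite mulrDr mulrCA; exact: resid.2.
rewrite Jhs in Jr; apply: (ideal_gen_sub hn) Jr => h'' hh''.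
by apply: (residual_act hN mBl) => //; exact: ideal0.
Qed.

(** * Krull's principal ideal theorem and regular local rings *)

Section KrullPrincipalIdeal.
Variable A : comNzRingType.
Hypothesis noethA : noetherian A.
Implicit Types (I J P Q N W : set A).

Definition colon I a : set A := [set u | I (a * u)].

Lemma colon_ideal I a : is_ideal I -> is_ideal (colon I a).
Proof.
move=> hI; split=> [|b x y Ix Iy]; rewrite /colon /= ?mulr0; first exact: ideal0.
by rewrite mulrDr mulrCA; exact: hI.2.
Qed.

Lemma sub_colon I a : is_ideal I -> I `<=` colon I a.
Proof. by move=> hI u Iu; exact: ideal_mull. Qed.

(** An associated prime of A/I: a maximal element among the proper colon ideals is prime. *)
Lemma exists_prime_colon I : is_ideal I -> ~ I 1 ->
  exists2 a, ~ I a & prime_ideal (colon I a).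
Proof.
move=> hI I1.
have [||M [a Ia ->] Mmax] :=
    @noetherian_max _ noethA [set C | exists2 a, ~ I a & C = colon I a].
- by exists (colon I 1), 1.
- by move=> _ [a _ ->]; exact: colon_ideal.
exists a => //; split; first exact: colon_ideal.
  by rewrite /colon /= mulr1.
move=> x y axy; apply: contrapT => /not_orP[ax ay]; apply: ax.
have <- : colon I (a * y) = colon I a.
  apply: Mmax; first by exists (a * y).
  by move=> u; rewrite /colon /= mulrAC => /(ideal_mulr y hI).
by rewrite /colon /= -mulrA [y * x]mulrC.
Qed.

Section Descending.
Variables (N P : set A) (x : A).
Hypotheses (primeN : prime_ideal N) (idP : is_ideal P).
Hypothesis minN : forall N', prime_ideal N' -> P `<=` N' -> N' x -> N' `<=` N ->
  N' = N.

(** In effect, A/I is Artinian after localization at N. Take a maximal counterexample M and an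
    associated prime [colon M a] of A/M; minimality makes it N, so M + (a) is locally one simple
    step above M. A chain either contains a throughout, or from some point on avoids a and is
    controlled by the chain of the ideals J + (a). *)
Lemma saturated_dcc I : is_ideal I -> saturated N I -> P `<=` I -> I x ->
  forall J : nat -> set A, (forall n, is_ideal (J n)) ->
  (forall n, saturated N (J n)) -> (forall n, J n.+1 `<=` J n) ->
  (forall n, I `<=` J n) -> exists n, J n `<=` J n.+1.
Proof.
move=> hI sI PI Ix; apply: contrapT => bad.
pose good I := forall J : nat -> set A, (forall n, is_ideal (J n)) ->
  (forall n, saturated N (J n)) -> (forall n, J n.+1 `<=` J n) ->
  (forall n, I `<=` J n) -> exists n, J n `<=` J n.+1.
have [||M [hM sM PM Mx badM] Mmax] := @noetherian_max _ noethA
    [set I | [/\ is_ideal I, saturated N I, P `<=` I, I x & ~ good I]].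
- by exists I; split.
- by move=> ? [].
have M1 : ~ M 1.
  move=> M1; apply: badM => J hJ _ _ MJ; exists 0%N => u _.
  by rewrite -[u]mulr1; apply: ideal_mull => //; exact: MJ.
have [a nMa pa] := exists_prime_colon hM M1.
have colonN : colon M a = N.
  apply: minN => //; first exact: subset_trans PM (sub_colon _ hM).
    exact: sub_colon.
  by move=> u Mau; apply: contrapT => /sM Nu; apply/nMa/Nu; rewrite mulrC.
have hM' := add_elt_ideal a hM.
have good_sat : good (sat N (add_elt M a)).
  apply: contrapT => bad'; apply: nMa.
  rewrite -(Mmax (sat N (add_elt M a))).
  - by apply: sub_sat => //; exact: add_elt_id.
  - split=> //.
    + exact: sat_ideal.
    + exact: sat_saturated.
    + by move=> u /PM Mu; apply: sub_sat => //; exact: sub_add_elt.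
    + by apply: sub_sat => //; exact: sub_add_elt.
  - by move=> u Mu; apply: sub_sat => //; exact: sub_add_elt.
apply: badM => J hJ sJ Jdec MJ.
have [aJ|] := pselect (forall n, J n a).
  apply: good_sat => // n u [s Ns]; move/(add_elt_sub (hJ n) (MJ n) (aJ n)).
  exact: sJ.
move=> /existsNP[k aJk].
have aJ n : ~ J (k + n)%N a.
  by elim: n => [|n IHn]; rewrite ?addn0 ?addnS // => /Jdec.
have [||||n hn] := good_sat (fun n => sat N (add_elt (J (k + n)%N) a)).
- by move=> n; apply: sat_ideal => //; exact: add_elt_ideal.
- by move=> n; exact: sat_saturated.
- move=> n; apply: sat_subset; apply: add_elt_sub; first exact: add_elt_ideal.
    by rewrite addnS; apply: subset_trans (Jdec _) _; exact: sub_add_elt.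
  exact: add_elt_id.
- move=> n; apply: sat_subset; apply: add_elt_sub; first exact: add_elt_ideal.
    by apply: subset_trans (MJ _) _; exact: sub_add_elt.
  exact: add_elt_id.
exists (k + n)%N => u Ju.
have [|s Ns [v Jv [r e1]]] := hn u; first by apply: sub_sat => //; exact: sub_add_elt.
rewrite addnS in Jv; apply: (sJ _ s) => //; rewrite e1; apply: idealD => //.
have Jra : J (k + n)%N (r * a).
  apply: (idealBK (hJ _) _ (idealN (hJ _) (Jdec _ _ Jv))).
  by rewrite opprK addrC -e1; exact: ideal_mull.
(* If r were outside N, saturation would put a in J; and N a is contained in M. *)
apply: MJ; have : N r by apply: contrapT => nNr; exact: aJ (sJ _ _ _ nNr Jra).
by rewrite -colonN /colon /= mulrC.
Qed.

End Descending.

(* Krull's principal ideal theorem, stated through chains: with [y] in [Q] but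
   not in [P], the contractions of the powers of [y] to the localization at [Q]
   stabilize by Nakayama's lemma at [N] if [N] is minimal over [P + (x)]. *)
Lemma prime_between P Q N x :
  prime_ideal P -> prime_ideal Q -> prime_ideal N -> P `<` Q -> Q `<` N -> N x ->
  exists N', [/\ prime_ideal N', P `<` N', N' `<` N & N' x].
Proof.
move=> hP hQ hN [PQ QP] [QN NQ] Nx; apply: contrapT => no.
have iP := prime_is_ideal hP; have iQ := prime_is_ideal hQ.
have iN := prime_is_ideal hN.
have nQx : ~ Q x by move=> Qx; apply: no; exists Q.
have minN N' : prime_ideal N' -> P `<=` N' -> N' x -> N' `<=` N -> N' = N.
  move=> hN' PN' N'x N'N; apply: contrapT => neq; apply: no; exists N'.
  split=> //; split=> //; first by move=> /(_ _ N'x)/PQ.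
  by move=> NN'; apply: neq; exact/seteqP.
have [y Qy nPy] : exists2 y, Q y & ~ P y.
  apply: contrapT => h; apply: QP => y Qy; apply: contrapT => nPy.
  by apply: h; exists y.
pose Y n := sat Q (add_elt P (y ^+ n)).
have iY n : is_ideal (Y n) by apply: sat_ideal => //; exact: add_elt_ideal.
have sY n : saturated N (Y n) by apply: saturated_sub QN _; exact: sat_saturated.
have Ydec n : Y n.+1 `<=` Y n.
  apply: sat_subset; apply: add_elt_sub; first exact: add_elt_ideal.
    exact: sub_add_elt.
  by rewrite exprS; apply: ideal_mull; [exact: add_elt_ideal|exact: add_elt_id].
have PY n : P `<=` Y n by apply: subset_trans (sub_sat hQ); exact: sub_add_elt.
pose J n := sat N (add_elt (Y n) x).
have iJ n : is_ideal (J n) by apply: sat_ideal => //; exact: add_elt_ideal.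
have iPx : is_ideal (add_elt P x) by exact: add_elt_ideal.
have [||||||||n hn] := @saturated_dcc N P x hN minN (sat N (add_elt P x)) _ _ _ _ J.
- exact: sat_ideal.
- exact: sat_saturated.
- by apply: subset_trans (sub_sat hN); exact: sub_add_elt.
- by apply: sub_sat => //; exact: add_elt_id.
- exact: iJ.
- by move=> n; exact: sat_saturated.
- move=> n; apply: sat_subset; apply: add_elt_sub; first exact: add_elt_ideal.
    by apply: subset_trans (Ydec _) _; exact: sub_add_elt.
  exact: add_elt_id.
- move=> n; apply: sat_subset; apply: add_elt_sub; first exact: add_elt_ideal.
    by apply: subset_trans (PY _) _; exact: sub_add_elt.
  exact: add_elt_id.
have Yn : Y n `<=` Y n.+1.
  apply: (nakayama_ideal noethA hN) => // u Yu.
  have [|s Ns [w Yw [r e1]]] := hn u.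
    by apply: sub_sat => //; exact: sub_add_elt.
  exists s => //; exists w => //; apply: sub_ideal_gen; exists x => //; exists r.
    (* The term r x is in Y n, and x is outside Q, so r itself is in Y n: this is what Nakayama's
       lemma needs. *)
    apply: (@sat_saturated _ Q _ hQ x) => //; rewrite -/(Y n).
    apply: (idealBK (iY n) _ (idealN (iY n) (Ydec _ _ Yw))).
    by rewrite opprK mulrC addrC -e1; exact: ideal_mull.
  by rewrite e1 addrAC subrr add0r mulrC.
have [|s nQs [w Pw [r e1]]] := Yn (y ^+ n).
  by apply: sub_sat => //; exact: add_elt_id.
(* From s y^n = w + r y^(n+1), the product (s - r y) y^n is in P, while s - r y is outside Q. *)
have nP : ~ P (s - r * y).
  move=> /PQ Qs; apply: nQs; apply: idealBK Qs _ => //; exact: ideal_mull.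
apply: nPy; apply: (@prime_exp _ _ _ n) => //; apply: prime_cancel nP _ => //.
have -> // : (s - r * y) * y ^+ n = w.
by rewrite mulrBl e1 exprS mulrA addrK.
Qed.

End KrullPrincipalIdeal.

(** * Regular parameters generate a chain of primes *)

Section RegularLocal.
Variable A : comNzRingType.
Hypothesis noethA : noetherian A.
Implicit Types (I J P Q N m : set A) (s : seq A).

Fixpoint prime_chain n P N : Prop :=
  prime_ideal P /\
  if n is n'.+1 then exists2 Q, P `<` Q & prime_chain n' Q N else P `<=` N.

Lemma prime_chain_prime n P N : prime_chain n P N -> prime_ideal P.
Proof. by case: n => [|n] []. Qed.

Lemma prime_chain_sub n P N : prime_chain n P N -> P `<=` N.
Proof.
by elim: n P => [|n IHn] P [_] // [Q [PQ _] /IHn]; exact: subset_trans.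
Qed.

(** Starting from the top, [prime_between] replaces each prime above P by one that contains x,
    without changing the length of the chain. *)
Lemma prime_chain_through n P N x : prime_ideal N -> N x ->
  prime_chain n.+1 P N -> exists Q, [/\ P `<` Q, Q x & prime_chain n Q N].
Proof.
move=> hN Nx; elim: n P => [|n IHn] P [hP [Q PQ cQ]].
  exists N; split=> //; last by split.
  by case: PQ => PQ QP; have QN := @prime_chain_sub 0 Q N cQ; split;
     [exact: subset_trans QN|move=> NP; apply: QP; exact: subset_trans NP].
have [Q' [QQ' Q'x cQ']] := IHn _ cQ.
have [N' [hN' PN' N'Q' N'x]] := prime_between noethA hP (proj1 cQ)
  (prime_chain_prime cQ') PQ QQ' Q'x.
by exists N'; split=> //; split=> //; exists Q'.
Qed.

Definition add_seq I s := foldl (@add_elt A) I s.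

Lemma add_seq_ideal I s : is_ideal I -> is_ideal (add_seq I s).
Proof. by elim: s I => //= x s IHs I hI; apply: IHs; exact: add_elt_ideal. Qed.

Lemma sub_add_seq I s : I `<=` add_seq I s.
Proof.
elim: s I => [|x s IHs] I /=; first exact: subset_refl.
by apply: subset_trans (IHs _); exact: sub_add_elt.
Qed.

Lemma add_seq_mem I s x : is_ideal I -> x \in s -> add_seq I s x.
Proof.
elim: s I => //= y s IHs I hI; rewrite inE => /orP[/eqP->|].
  by apply: sub_add_seq; exact: add_elt_id.
by apply: IHs; exact: add_elt_ideal.
Qed.

Lemma add_seq_sub I s J : is_ideal J -> I `<=` J -> [set` s] `<=` J ->
  add_seq I s `<=` J.
Proof.
move=> hJ; elim: s I => //= x s IHs I IJ sJ; apply: IHs.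
  by apply: add_elt_sub => //; apply: sJ; exact: mem_head.
by move=> y ys; apply: sJ; rewrite /= inE (ys : y \in s) orbT.
Qed.

Lemma ideal_gen_add_seq s : ideal_gen [set` s] = add_seq [set 0] s.
Proof.
have h0 : is_ideal ([set 0] : set A).
  by split=> // a x y -> ->; rewrite mulr0 addr0.
apply/seteqP; split.
  by apply: ideal_gen_sub; [exact: add_seq_ideal|move=> x; exact: add_seq_mem].
apply: add_seq_sub; [exact: ideal_gen_ideal| |exact: sub_ideal_gen].
by move=> _ ->; apply: ideal0; exact: ideal_gen_ideal.
Qed.

(** Krull's height bound: once the chain is routed through the first generator, only its first step
    is lost. *)
Lemma prime_chain_bound m s I n P : prime_ideal m -> is_ideal I ->
  m = add_seq I s -> I `<=` P -> prime_chain n P m -> (n <= size s)%N.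
Proof.
move=> hm; elim: s I n P => [|x s IHs] I [|n] P //= hI mE IP cP.
  have [_ [Q [PQ QP] /prime_chain_sub Qm]] := cP.
  by case: QP; apply: subset_trans IP; rewrite -mE.
have mx : m x by rewrite mE; apply: (@add_seq_mem I (x :: s)) => //; exact: mem_head.
have [Q [[PQ _] Qx cQ]] := prime_chain_through hm mx cP.
apply: (IHs (add_elt I x) n Q) => //; first exact: add_elt_ideal.
apply: add_elt_sub => //; first exact/prime_is_ideal/(prime_chain_prime cQ).
exact: subset_trans PQ.
Qed.

Fixpoint prime_seq m I s : Prop :=
  if s is x :: s' then [/\ prime_ideal I, ~ I x & prime_seq m (add_elt I x) s']
  else I = m.

Definition local_at m := maximal_ideal m /\ forall u, ~ m u -> exists v, u * v = 1.

Lemma local_saturated m I : local_at m -> is_ideal I -> saturated m I.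
Proof.
move=> [_ um] hI s u ms; have [v sv] := um s ms => /(ideal_mull v hI).
by rewrite mulrA [v * s]mulrC sv mul1r.
Qed.

Lemma local_prime m : local_at m -> prime_ideal m.
Proof. by case=> /maximal_prime. Qed.

(** The chain has the maximal length, so x is not in P: otherwise the remaining generators would
    bound the chain too tightly. By induction I + (x) is the next prime, which contains P; an
    element i + r x of P has r in P, so P = I + xP and Nakayama's lemma gives P = I. *)
Lemma prime_chain_seq m s I P : local_at m -> is_ideal I -> m = add_seq I s ->
  I `<=` P -> prime_chain (size s) P m -> prime_seq m I s /\ I = P.
Proof.
move=> loc; have hm := local_prime loc.
elim: s I P => [|x s IHs] I P hI mE IP cP /=.
  by split=> //; apply/seteqP; split=> //; rewrite -[I]mE; exact: prime_chain_sub cP.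
have hP := prime_chain_prime cP; have iP := prime_is_ideal hP.
have mx : m x by rewrite mE; apply: (@add_seq_mem I (x :: s)) => //; exact: mem_head.
have nPx : ~ P x.
  move=> Px; have := @prime_chain_bound m s (add_elt I x) _ P hm
    (add_elt_ideal x hI) mE (add_elt_sub iP IP Px) cP.
  by rewrite ltnn.
have [Q [[PQ _] Qx cQ]] := prime_chain_through hm mx cP.
have [|psQ IxQ] := IHs (add_elt I x) Q (add_elt_ideal x hI) mE _ cQ.
  apply: add_elt_sub => //; first exact/prime_is_ideal/(prime_chain_prime cQ).
  exact: subset_trans PQ.
have IPE : I = P.
  apply/seteqP; split=> //.
  apply: (nakayama_ideal noethA hm) => //; first exact: local_saturated.
  move=> u Pu; exists 1; first by case: hm.
  have [i Ii [r e1]] : add_elt I x u by rewrite IxQ; exact: PQ.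
  exists i => //; apply: sub_ideal_gen; exists x => //; exists r; last first.
    by rewrite mul1r e1 addrAC subrr add0r mulrC.
  apply: (prime_cancel hP nPx).
  apply: (idealBK iP _ (idealN iP (IP _ Ii))).
  by rewrite opprK addrC mulrC -e1.
by subst P; split.
Qed.

Lemma regular_prime_seq : regular_local_ring A ->
  exists m s, local_at m /\ prime_seq m [set 0] s.
Proof.
move=> [_ [m [maxm uniqm [s [mE [[c [pc cinc]] _]]]]]].
have loc : local_at m.
  split=> // u mu; apply: contrapT => nu.
  have [||M maxM uM] := @ideal_sub_maximal A noethA [set v | exists r, v = u * r].
  - split; first by exists 0; rewrite mulr0.
    by move=> a _ _ [r ->] [t ->]; exists (a * r + t); ring.
  - by move=> [r e1]; apply: nu; exists r.
  by apply: mu; rewrite -(uniqm _ maxM); apply: uM; exists 1; rewrite mulr1.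
have cm i : c i `<=` m.
  have [ic c1 _] := pc i.
  by have [M maxM] := ideal_sub_maximal noethA ic c1; rewrite (uniqm _ maxM).
(* The given chain increases with its index, so a chain of length k starts k places below the
   top. *)
have chain k : (k <= size s)%N -> prime_chain k (c (inord (size s - k))) m.
  elim: k => [|k IHk] ks; first by split.
  split=> //; exists (c (inord (size s - k))); last exact/IHk/ltnW.
  by apply: cinc; rewrite !inordK ?ltnS ?leq_subr // ltn_sub2l.
exists m, s; split=> //.
have h0 : is_ideal ([set 0] : set A).
  by split=> // a x y -> ->; rewrite mulr0 addr0.
apply: (proj1 (@prime_chain_seq m s _ (c (inord (size s - size s))) _ _ _ _ _)) => //.
- by rewrite -ideal_gen_add_seq.
- by move=> _ ->; apply: ideal0; apply: prime_is_ideal.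
- exact: chain.
Qed.

End RegularLocal.

(** * Freeness over the subring of p-th powers *)

Section FrobeniusPower.
Variables (A : comNzRingType) (p : nat).
Hypothesis charA : p \in [pchar A].

Lemma pchar_gt0 : (0 < p)%N.
Proof. exact/prime_gt0/(pcharf_prime charA). Qed.

Lemma pchar_nat e : [pchar A].-nat (p ^ e)%N.
Proof. by rewrite pnatX pnatE ?charA // (pcharf_prime charA). Qed.

Lemma frobD e (x y : A) : (x + y) ^+ (p ^ e) = x ^+ (p ^ e) + y ^+ (p ^ e).
Proof. by apply: exprDn_pchar; exact: pchar_nat. Qed.

Lemma frobB e (x y : A) : (x - y) ^+ (p ^ e) = x ^+ (p ^ e) - y ^+ (p ^ e).
Proof. by apply: (canRL (addrK _)); rewrite -frobD subrK. Qed.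

Lemma frobB1 (x y : A) : (x - y) ^+ p = x ^+ p - y ^+ p.
Proof. by have := frobB 1 x y; rewrite !expn1. Qed.

Lemma frobD1 (x y : A) : (x + y) ^+ p = x ^+ p + y ^+ p.
Proof. by have := frobD 1 x y; rewrite !expn1. Qed.

Definition pcomb (T : finType) (y c : T -> A) := \sum_t c t ^+ p * y t.

Lemma pcombB (T : finType) (y c d : T -> A) :
  pcomb y (fun t => c t - d t) = pcomb y c - pcomb y d.
Proof. by rewrite -sumrB; apply: eq_bigr => t _; rewrite frobB1 mulrBl. Qed.

Lemma pcombD (T : finType) (y c d : T -> A) :
  pcomb y (fun t => c t + d t) = pcomb y c + pcomb y d.
Proof. by rewrite -big_split; apply: eq_bigr => t _; rewrite frobD1 mulrDl. Qed.

Lemma pcombZ (T : finType) (y c : T -> A) a :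
  pcomb y (fun t => a * c t) = a ^+ p * pcomb y c.
Proof. by rewrite mulr_sumr; apply: eq_bigr => t _; rewrite exprMn mulrA. Qed.

Lemma pcomb_ideal (T : finType) (y c : T -> A) (I : set A) : is_ideal I ->
  (forall t, I (c t)) -> I (pcomb y c).
Proof.
move=> hI Ic; apply: ideal_sum => // t _; apply: ideal_mulr => //.
by apply: idealX => //; exact: pchar_gt0.
Qed.

(** For prime I, c^p is in I only if c is; the classes of y then form a basis of A/I over its
    subring of p-th powers. *)
Definition pbasis_mod (I : set A) (T : finType) (y : T -> A) : Prop :=
  (forall c, I (pcomb y c) -> forall t, I (c t)) /\
  (forall a, exists c, I (a - pcomb y c)).

Section Local.
Hypothesis noethA : noetherian A.
Hypothesis finA : F_finite p A.
Variable m : set A.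
Hypothesis loc : local_at m.

(** A spanning family of least size is independent: in a relation, a coefficient outside m is a
    unit, and its generator could be eliminated. *)
Lemma residue_pbasis : exists n (y : 'I_n -> A), pbasis_mod m y.
Proof.
have hm := prime_is_ideal (local_prime loc).
have /ex_minnP[n /asboolP[y geny] minn] : exists n,
    `[< exists y : 'I_n -> A, forall a, exists c, m (a - pcomb y c) >].
  have [n [g gP]] := finA; exists n; apply/asboolP; exists g => a.
  by have [c ->] := gP a; exists c; rewrite subrr; exact: ideal0.
exists n, y; split=> // c mc j; apply: contrapT => mcj.
have [v cjv] := loc.2 _ mcj.
have n_gt0 : (0 < n)%N := leq_ltn_trans (leq0n j) (ltn_ord j).
suff : (n <= n.-1)%N by rewrite -ltnS prednK // ltnn.
apply: minn; apply/asboolP; exists (fun i => y (lift j i)) => a.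
have [d md] := geny a; exists (fun i => d (lift j i) - d j * v * c (lift j i)).
have := pcombB y d (fun t => d j * v * c t); rewrite pcombZ.
rewrite {1}/pcomb (bigD1_ord j) //= -!mulrA [v * c j]mulrC cjv mulr1 subrr.
rewrite expr0n gtn_eqF ?pchar_gt0 // mul0r add0r => E.
rewrite /pcomb /=; rewrite E opprB addrA addrAC; apply: idealD => //; exact: ideal_mull.
Qed.

Variables (I : set A) (x : A).
Hypotheses (primeI : prime_ideal I) (Im : I `<=` m) (nIx : ~ I x) (mx : m x).
Variables (T : finType) (y : T -> A).
Hypothesis basisy : pbasis_mod (add_elt I x) y.
Let iI : is_ideal I. Proof. exact: prime_is_ideal. Qed.
Let iIx : is_ideal (add_elt I x). Proof. exact: add_elt_ideal. Qed.

Definition lift_family (t : 'I_p * T) : A := x ^+ t.1 * y t.2.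

Lemma pcomb_lift c : pcomb lift_family c =
  \sum_(i < p) x ^+ i * pcomb y (fun t => c (i, t)).
Proof.
under [RHS]eq_bigr do rewrite mulr_sumr.
by rewrite pair_bigA; apply: eq_bigr => -[i t] _; rewrite mulrCA.
Qed.

(** Division by x repeated p times: each remainder is expanded modulo I + (x), and the error gives
    the next remainder. *)
Lemma lift_gen_mod a : exists c r, I (a - pcomb lift_family c - x ^+ p * r).
Proof.
suff [d [r Ir]] : exists (d : nat -> T -> A) r,
    I (a - \sum_(i < p) x ^+ i * pcomb y (d i) - x ^+ p * r).
  by exists (fun t : 'I_p * T => d t.1 t.2), r; rewrite pcomb_lift.
(* Only the number of powers of x varies in the induction; the Frobenius exponent inside [pcomb]
   stays p. *)
elim: (p) => [|k [d [r Ir]]].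
  exists (fun _ _ => 0), a; rewrite big_ord0 expr0 mul1r subr0 subrr.
  exact: ideal0.
have [dk [i Ii [r' e1]]] := basisy.2 r.
exists (fun i => if (i < k)%N then d i else dk), r'.
rewrite big_ord_recr /= ltnn.
rewrite (eq_bigr (fun i : 'I_k => x ^+ i * pcomb y (d i))) => [|j _]; last by rewrite ltn_ord.
set S := \sum_(i < k) _ in Ir *; have er : r = pcomb y dk + (i + r' * x) by rewrite -e1 addrC subrK.
have -> : a - (S + x ^+ k * pcomb y dk) - x ^+ k.+1 * r' = (a - S - x ^+ k * r) + x ^+ k * i.
  by rewrite er exprS; ring.
by apply: idealD => //; exact: ideal_mull.
Qed.

(** The remainder x^p r is absorbed by Nakayama's lemma for the Frobenius action: with r = sum d_k^p
    g_k it becomes the sum of [act (x * d k) (g k)], and x d_k is in m. *)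
Lemma lift_gen a : exists c, I (a - pcomb lift_family c).
Proof.
pose act (a v : A) := a ^+ p * v.
pose W := [set a | exists c, I (a - pcomb lift_family c)].
have W0 : W 0.
  exists (fun=> 0); rewrite sub0r; apply: idealN => //; apply: pcomb_ideal => // t.
  exact: ideal0.
have WB u v : W u -> W v -> W (u - v).
  move=> [c Iu] [d Iv]; exists (fun t => c t - d t); rewrite pcombB.
  have -> : u - v - (pcomb lift_family c - pcomb lift_family d) =
    (u - pcomb lift_family c) - (v - pcomb lift_family d) by ring.
  exact: idealB.
have WA b v : W v -> W (act b v).
  move=> [c Iv]; exists (fun t => b * c t); rewrite pcombZ /act -mulrBr.
  exact: ideal_mull.
have actA b d v : act (b * d) v = act b (act d v) by rewrite /act exprMn mulrA.
have actB b : zmod_morphism (act b) by move=> u v; rewrite /act mulrBr.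
have actBl v : zmod_morphism (act^~ v) by move=> b d; rewrite /act frobB1 mulrBl.
have Wsat s v : ~ m s -> W (act s v) -> W v.
  move=> ms /(WA (xget 0 [set w | s * w = 1])); rewrite -actA.
  case: xgetP => [w _ /= sw|]; first by rewrite mulrC sw /act expr1n mul1r.
  by have [w sw] := loc.2 _ ms; move=> /(_ w).
have [n [g gP]] := finA.
have hm := local_prime loc.
have Wg i : W (g i).
  apply: (@nakayama A m hm act actB actBl actA W W0 WB WA Wsat (codom g));
    last exact: codom_f.
  move=> _ /codomP[j ->]; exists 1; first by case: hm.
  have [c [r Ir]] := lift_gen_mod (g j); have [d rE] := gP r.
  pose res := residual m act W (codom g).
  have res0 : res 0 by exact: residual0.
  have resB u v : res u -> res v -> res (u - v) by exact: residualB.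
  have -> : act 1 (g j) = (g j - x ^+ p * r) - (0 - x ^+ p * r).
    by rewrite /act expr1n; ring.
  apply: (resB); first by apply: sub_residual => //; exists c; rewrite addrAC.
  apply: (resB) => //; rewrite rE mulr_sumr.
  elim/big_rec: _ => // k v _ rv; rewrite -[v]opprK -[- v]sub0r.
  apply: (resB); last exact: resB.
  have -> : x ^+ p * (d k ^+ p * g k) = act (x * d k) (g k).
    by rewrite /act exprMn mulrA.
  apply: residual_act => //; last exact: codom_f.
  by apply: ideal_mulr mx; exact: prime_is_ideal.
change (W a); have [c ->] := gP a.
elim/big_rec: _ => // i v _ Wv; rewrite -[v]opprK -[- v]sub0r.
by apply: (WB); [exact: (WA (c i) (g i))|exact: WB].
Qed.

(** Induction on the power k of x. Coefficients of lower powers are in I + (x), so their p-th powers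
    are in I + (x^p); higher terms are divisible by x^(k+1). Hence the k-th term is in I +
    (x^(k+1)), and x^k cancels modulo I. *)
Lemma lift_indep_mod c : I (pcomb lift_family c) -> forall t, add_elt I x (c t).
Proof.
rewrite pcomb_lift => Ic.
suff h k : (k < p)%N -> forall i : 'I_p, (i <= k)%N -> forall t, add_elt I x (c (i, t)).
  by move=> [i t]; apply: (h i).
pose b i := pcomb y (fun t => c (i, t)).
elim/ltn_ind: k => k IHk kp i ik.
have [ik'|ki] := ltnP i k; first by apply: (IHk i).
have {ik ki} -> : i = Ordinal kp by apply/val_inj/anti_leq; rewrite ik ki.
set k' := Ordinal kp.
apply: basisy.1 => /=.
have Ixk : is_ideal (add_elt I (x ^+ k.+1)) by exact: add_elt_ideal.
have [u Iu [r e1]] : add_elt I (x ^+ k.+1) (\sum_(i < p | i != k') x ^+ i * b i).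
  apply: ideal_sum => // j; rewrite -val_eqE /= neq_ltn => /orP[jk|kj]; last first.
    rewrite mulrC -(subnK kj) exprD mulrA; apply: ideal_mull => //.
    exact: add_elt_id.
  apply: ideal_mull => //.
  have hc := IHk _ jk (ltn_ord j) j (leqnn _).
  rewrite /b; apply: ideal_sum => // t _; apply: ideal_mulr => //.
  have [v Iv [s ->]] := hc t; rewrite frobD1 exprMn.
  apply: idealD => //.
    by apply: sub_add_elt; apply: idealX => //; exact: pchar_gt0.
  apply: ideal_mull => //; rewrite -(subnK kp) exprD; apply: ideal_mull => //.
  exact: add_elt_id.
move: Ic; rewrite (bigD1 k') //= -/(b k') e1 => Ic.
exists (b k' + r * x); last by exists (- r); rewrite mulNr addrK.
apply: (@prime_cancel _ I (x ^+ k)) => //; first by move=> /(prime_exp primeI).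
apply: (idealBK iI _ (idealN iI Iu)).
by rewrite opprK mulrDr mulrCA -exprSr -addrA [r * _ + u]addrC.
Qed.

(** Modulo I, all coefficients of a relation are divisible by x, and dividing them by x gives
    another relation. So the ideal C of t-th coefficients satisfies C inside I + xC, and Nakayama's
    lemma applies. *)
Lemma lift_indep c : I (pcomb lift_family c) -> forall t, I (c t).
Proof.
move=> Ic t; pose C := [set u | exists2 c, I (pcomb lift_family c) & u = c t].
suff : C `<=` I by apply; exists c.
have hm := local_prime loc.
apply: (nakayama_ideal noethA hm) => //.
- split; first by exists (fun=> 0) => //; apply: pcomb_ideal => // ?; exact: ideal0.
  move=> a _ _ [d Id ->] [d' Id' ->]; exists (fun t => a * d t + d' t) => //.
  by rewrite pcombD pcombZ; exact: iI.2.
- exact: local_saturated.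
move=> _ [d Id ->]; exists 1; first by case: hm.
have /choice[f fP] : forall t, exists ir, I ir.1 /\ d t = ir.1 + ir.2 * x.
  by move=> t'; have [i Ii [r e1]] := lift_indep_mod Id t'; exists (i, r).
exists (f t).1; first by case: (fP t).
apply: sub_ideal_gen; exists x => //; exists (f t).2; last first.
  by rewrite mul1r {1}(fP t).2 addrAC subrr add0r mulrC.
exists (fun t => (f t).2) => //.
apply: (@prime_cancel _ I (x ^+ p)) => //; first by move=> /(prime_exp primeI).
rewrite -pcombZ.
have -> : (fun t => x * (f t).2) = (fun t => d t - (f t).1).
  by apply/funext => t'; rewrite (fP t').2 addrAC subrr add0r mulrC.
rewrite pcombB; apply: idealB => //; apply: pcomb_ideal => // t'.
by case: (fP t').
Qed.

End Local.

Lemma prime_seq_sub (m I : set A) s : is_ideal m -> prime_seq m I s -> I `<=` m.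
Proof.
move=> hm; elim: s I => [|x s IHs] I /=; first by move=> ->.
by move=> [_ _ /IHs]; apply: subset_trans; exact: sub_add_elt.
Qed.

Lemma prime_seq_pbasis (m I : set A) s : noetherian A -> F_finite p A ->
  local_at m -> prime_seq m I s ->
  exists (T : finType) (y : T -> A), pbasis_mod I y.
Proof.
move=> noethA finA loc; elim: s I => [|x s IHs] I /=.
  by move=> ->; have [n [y yP]] := residue_pbasis finA loc; exists 'I_n, y.
move=> [pI nIx ps]; have [T [y yP]] := IHs _ ps.
have hm := prime_is_ideal (local_prime loc).
have Ixm := prime_seq_sub hm ps.
have Im : I `<=` m by apply: subset_trans Ixm; exact: sub_add_elt.
have mx : m x by apply: Ixm; apply: add_elt_id; exact: prime_is_ideal.
exists ('I_p * T)%type, (lift_family x y); split.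
  by move=> c; exact: (lift_indep noethA loc).
by move=> a; exact: (lift_gen finA loc).
Qed.

Theorem regular_local_pbasis : regular_local_ring A -> F_finite p A ->
  exists (T : finType) (y : T -> A), pbasis_mod [set 0] y.
Proof.
move=> reg finA; have noethA := reg.1.
by have [m [s [loc /prime_seq_pbasis]]] := regular_prime_seq noethA reg; apply.
Qed.

End FrobeniusPower.

(** * From local to global dual bases *)

Section LocalizationEmbedding.
Variables (A : idomainType) (S : mulrClosed A).
Local Notation "x %:F" := (@tofrac _ x).

Definition loc_emb (a : A) : loc S := loc_frac a (rpred1 S).

Lemma loc_val_inj : injective (@loc_val A S).
Proof. exact: val_inj. Qed.

Lemma loc_valB (x y : loc S) : loc_val (x - y) = loc_val x - loc_val y.
Proof. exact: (raddfB (val : loc S -> _)). Qed.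

Lemma loc_valM (x y : loc S) : loc_val (x * y) = loc_val x * loc_val y.
Proof. exact: (rmorphM (val : loc S -> _)). Qed.

Lemma loc_val1 : loc_val (1 : loc S) = 1.
Proof. exact: (rmorph1 (val : loc S -> _)). Qed.

Lemma val_loc_emb a : loc_val (loc_emb a) = a%:F.
Proof. by rewrite /= tofrac1 divr1. Qed.

Lemma loc_emb_is_zmod_morphism : zmod_morphism loc_emb.
Proof. by move=> a b; apply: loc_val_inj; rewrite loc_valB !val_loc_emb tofracB. Qed.

Lemma loc_emb_is_monoid_morphism : monoid_morphism loc_emb.
Proof.
split; first by apply: loc_val_inj; rewrite loc_val1 val_loc_emb tofrac1.
by move=> a b; apply: loc_val_inj; rewrite loc_valM !val_loc_emb tofracM.
Qed.

HB.instance Definition _ :=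
  GRing.isZmodMorphism.Build A (loc S) loc_emb loc_emb_is_zmod_morphism.
HB.instance Definition _ :=
  GRing.isMonoidMorphism.Build A (loc S) loc_emb loc_emb_is_monoid_morphism.

Lemma loc_emb_inj : injective loc_emb.
Proof.
by move=> a b /(congr1 (@loc_val _ _)); rewrite !val_loc_emb => /eqP; rewrite tofrac_eq => /eqP.
Qed.

Hypothesis S0 : 0 \notin S.

Lemma loc_emb_denom (z : loc S) : exists a s, s \in S /\ loc_emb s * z = loc_emb a.
Proof.
have /loc_predP[a [s [Ss zE]]] := valP z; exists a, s; split=> //.
apply: loc_val_inj; rewrite loc_valM !val_loc_emb zE mulrC divfK // tofrac_eq0.
by apply: contraNneq S0 => <-.
Qed.

Lemma loc_emb_mulI s : s \in S -> injective (fun z : loc S => loc_emb s * z).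
Proof.
move=> Ss z w /(congr1 (@loc_val _ _)); rewrite !loc_valM val_loc_emb => E.
apply: loc_val_inj; apply: mulfI E.
by rewrite tofrac_eq0; apply: contraNneq S0 => <-.
Qed.

Lemma loc_common_denom (U : finType) (z : U -> loc S) :
  exists2 s, s \in S & forall u, exists a, loc_emb s * z u = loc_emb a.
Proof.
suff [s Ss sP] : exists2 s, s \in S &
    forall u, u \in enum U -> exists a, loc_emb s * z u = loc_emb a.
  by exists s => // u; apply: sP; rewrite mem_enum.
elim: (enum U) => [|v l [s Ss sP]]; first by exists 1; rewrite ?rpred1.
have [a [t [St tz]]] := loc_emb_denom (z v).
exists (s * t) => [|u]; first exact: rpredM.
rewrite inE rmorphM => /orP[/eqP->|/sP[b sb]].
  by exists (s * a); rewrite -mulrA tz rmorphM.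
by exists (t * b); rewrite mulrAC sb -rmorphM mulrC.
Qed.

Lemma loc_pchar p : p \in [pchar A] -> p \in [pchar loc S].
Proof. exact: (rmorph_pchar loc_emb). Qed.

Lemma loc_F_finite p : (0 < p)%N -> F_finite p A -> F_finite p (loc S).
Proof.
move=> p0 [n [g gP]]; exists n, (fun i => loc_emb (g i)) => z.
have /loc_predP[a [s [Ss zE]]] := valP z.
(* a/s is rewritten as (a s^(p-1))/s^p, whose denominator is a p-th power. *)
have [c cE] := gP (a * s ^+ p.-1).
exists (fun i => loc_frac (c i) Ss); apply: (@loc_emb_mulI (s ^+ p)); first exact: rpredX.
have s0 : s%:F != 0 by rewrite tofrac_eq0; apply: contraNneq S0 => <-.
rewrite mulr_sumr (_ : _ * z = loc_emb (a * s ^+ p.-1)); last first.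
  apply: loc_val_inj; rewrite loc_valM !val_loc_emb zE -{1}(prednK p0) exprSr !tofracM.
  by rewrite mulrACA divff // mulr1 mulrC.
rewrite cE rmorph_sum; apply: eq_bigr => i _; rewrite mulrA rmorphM /=; congr (_ * _).
rewrite rmorphXn [RHS](_ : _ = (loc_emb s * loc_frac (c i) Ss) ^+ p); last first.
  by rewrite exprMn rmorphXn.
congr (_ ^+ _); apply: loc_val_inj; rewrite loc_valM !val_loc_emb /=.
by rewrite mulrC divfK.
Qed.

End LocalizationEmbedding.

Section FrobeniusSplitting.
Variables (R : idomainType) (p : nat).
Hypotheses (charR : p \in [pchar R]) (finR : F_finite p R) (regR : regular_ring R).

(* Equivalently, [u -> phi u ^+ q] is an R^q-linear form on R. *)
Definition root_linear (q : nat) (phi : R -> R) : Prop :=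
  zmod_morphism phi /\ forall a x, phi (a ^+ q * x) = a * phi x.

(* A dual basis of R over R^q if [a = 1].  The [a] admitting such families form an
   ideal, which reduces existence for [a = 1] to localizations at maximal ideals. *)
Definition dual_basis (q : nat) (T : finType) (phi : T -> R -> R) (g : T -> R)
    (a : R) : Prop :=
  (forall t, root_linear q (phi t)) /\
  forall x, a ^+ q * x = \sum_t phi t x ^+ q * g t.

(** As (a u + v)^p = a^p u^p + v^p, two families are combined by concatenation. *)
Lemma dual_basis_ideal :
  is_ideal [set a | exists (T : finType) phi g, @dual_basis p T phi g a].
Proof.
split.
  exists void, (fun _ _ => 0), (fun=> 0); split=> [[]|x].
  by rewrite big1 => [|[]]; rewrite expr0n gtn_eqF ?(pchar_gt0 charR) // mul0r.
move=> a u v [T [phi [g [hphi E]]]] [T' [phi' [g' [hphi' E']]]].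
exists (T + T')%type, (fun t => match t with inl t => fun x => a * phi t x
  | inr t => phi' t end), (fun t => match t with inl t => g t | inr t => g' t end).
split=> [[t|t]|x] /=.
- have [phiB phiZ] := hphi t; split=> [x y|b x]; first by rewrite phiB mulrBr.
  by rewrite phiZ mulrCA.
- exact: hphi'.
rewrite big_sumType /= frobD1 // mulrDl exprMn -mulrA E E' mulr_sumr.
by congr (_ + _); apply: eq_bigr => t _; rewrite exprMn mulrA.
Qed.

(** Coordinates [psi] for a basis of the localization have values in the localization. By
    p-linearity one s1 that clears them on the finitely many generators g clears them on all of R;
    s2 clears the basis elements. *)
Lemma dual_basis_localization (P : set R) (hP : prime_ideal P) :
  regular_local_ring (loc (prime_compl hP)) ->
  exists2 s, ~ P s & exists (T : finType) phi g, @dual_basis p T phi g s.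
Proof.
move=> regL; pose L : comNzRingType := loc (prime_compl hP).
pose iota : {rmorphism R -> L} := @loc_emb R (prime_compl hP).
have p0 := pchar_gt0 charR.
have memS s : s \in prime_compl hP -> ~ P s.
  by move=> /negP Ss /mem_set.
have S0 : 0 \notin prime_compl hP.
  by apply/negP => /memS; apply; exact: ideal0 (prime_is_ideal hP).
have charL : p \in [pchar L] := loc_pchar (prime_compl hP) charR.
have [T [y [indy geny]]] :=
  regular_local_pbasis charL regL (loc_F_finite S0 p0 finR).
have /choice[psi psiP] : forall x, exists c, iota x = pcomb p y c.
  by move=> x; have [c /subr0_eq E] := geny (iota x); exists c.
have uniq_psi x c : iota x = pcomb p y c -> forall t, psi x t = c t.
  move=> E t; apply: subr0_eq; apply: (indy (fun t => psi x t - c t)).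
  by rewrite pcombB // -psiP -E subrr.
have psiB x z t : psi (x - z) t = psi x t - psi z t.
  apply: (uniq_psi _ (fun t => psi x t - psi z t)).
  by rewrite pcombB // -!psiP rmorphB.
have psi0 t : psi 0 t = 0 by have := psiB 0 0 t; rewrite !subrr.
have psiZ a x t : psi (a ^+ p * x) t = iota a * psi x t.
  apply: (uniq_psi _ (fun t => iota a * psi x t)).
  by rewrite pcombZ -psiP rmorphM rmorphXn.
have [n [g gP]] := finR.
have [s1 Ss1 s1P] : exists2 s, s \in prime_compl hP &
    forall u : 'I_n * T, exists a, iota s * psi (g u.1) u.2 = iota a.
  exact: loc_common_denom.
have [s2 Ss2 /choice[h hP2]] : exists2 s, s \in prime_compl hP &
    forall t : T, exists a, iota s * y t = iota a.
  exact: loc_common_denom.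
have /choice[phi phiP] : forall tx : T * R, exists r, iota s1 * psi tx.2 tx.1 = iota r.
  move=> [t x] /=; have [b ->] := gP x.
  elim/big_rec: _ => [|i z _ [r rE]].
    by exists 0; rewrite psi0 mulr0 raddf0.
  have [a aE] := s1P (i, t).
  exists (b i * a + r); rewrite -[z]opprK psiB -[- z]sub0r psiB.
  by rewrite psi0 sub0r opprK mulrDr rE psiZ mulrCA aE -rmorphM -rmorphD.
have inj : injective iota := @loc_emb_inj R (prime_compl hP).
exists (s1 * s2); first by apply: prime_complM => //; exact: memS.
exists T, (fun t x => phi (t, x)), (fun t => s2 ^+ p.-1 * h t).
split=> [t|x].
  split=> [x z|a x]; apply: inj.
    by rewrite rmorphB -!phiP /= psiB mulrBr.
  by rewrite rmorphM -!phiP /= psiZ mulrCA.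
have -> : \sum_t phi (t, x) ^+ p * (s2 ^+ p.-1 * h t) =
          s2 ^+ p.-1 * \sum_t phi (t, x) ^+ p * h t.
  by rewrite mulr_sumr; apply: eq_bigr => t _; rewrite mulrCA.
(* Clearing denominators yields s1^p s2; the factor s2^(p-1) put into the dual family completes a
   p-th power. *)
have -> : (s1 * s2) ^+ p * x = s2 ^+ p.-1 * (s1 ^+ p * s2 * x).
  by rewrite exprMn -{2}(prednK p0) exprSr; ring.
congr (_ * _); apply: inj; rewrite !(rmorphM iota) (rmorphXn iota) (psiP x).
rewrite (rmorph_sum iota) /pcomb mulr_sumr; apply: eq_bigr => t _.
by rewrite (rmorphM iota) (rmorphXn iota) -phiP -hP2 /= exprMn; ring.
Qed.

Lemma exists_dual_basis e :
  exists (T : finType) phi g, @dual_basis (p ^ e) T phi g 1.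
Proof.
elim: e => [|e [T [phi [g [hphi E]]]]].
  exists 'I_1, (fun _ => id), (fun=> 1); split=> [_|x]; first by split=> // a x; rewrite expr1.
  by rewrite big_ord1 expr1n mul1r expr1 mulr1.
have [S [psi [h [hpsi E']]]] : exists (T : finType) phi g, @dual_basis p T phi g 1.
  apply: contrapT => no.
  have [M maxM sM] := ideal_sub_maximal regR.1 dual_basis_ideal no.
  have [s nMs sP] := dual_basis_localization (regR.2 M (maximal_prime maxM)).
  exact/nMs/sM.
(* The coordinates over R^(p^e) are themselves expanded over R^p. *)
exists (T * S)%type, (fun ts x => psi ts.2 (phi ts.1 x)),
  (fun ts => h ts.2 ^+ (p ^ e) * g ts.1); split=> [[t s]|x] /=.
  have [phiB phiZ] := hphi t; have [psiB psiZ] := hpsi s.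
  split=> [x y|a x]; first by rewrite phiB psiB.
  by rewrite expnS exprM phiZ psiZ.
rewrite -(pair_bigA _ (fun t s => psi s (phi t x) ^+ (p ^ e.+1) *
  (h s ^+ (p ^ e) * g t))) /= expr1n -[1](expr1n _ (p ^ e)) E.
apply: eq_bigr => t _.
have := E' (phi t x); rewrite expr1n mul1r => {1}->.
have -> : (\sum_s psi s (phi t x) ^+ p * h s) ^+ (p ^ e) =
    \sum_s (psi s (phi t x) ^+ p * h s) ^+ (p ^ e).
  elim/big_rec2: _ => [|s u v _ <-]; last by rewrite frobD.
  by rewrite expr0n gtn_eqF // expn_gt0 (pchar_gt0 charR).
by rewrite mulr_suml; apply: eq_bigr => s _; rewrite exprMn -exprM -expnS mulrA.
Qed.

End FrobeniusSplitting.

(** * Frobenius roots and test ideals *)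

Section FrobeniusRoots.
Variables (R : idomainType) (p : nat).
Hypotheses (charR : p \in [pchar R]) (finR : F_finite p R) (regR : regular_ring R).
Implicit Types (I J : set R).

Lemma frob_power_ideal J e : is_ideal (frob_power p J e).
Proof. exact: ideal_gen_ideal. Qed.

Lemma frob_power_mem J e u : J u -> frob_power p J e (u ^+ (p ^ e)).
Proof. by move=> Ju; apply: sub_ideal_gen; exists u. Qed.

Lemma frob_powerS I J e : I `<=` J -> frob_power p I e `<=` frob_power p J e.
Proof.
move=> IJ; apply: ideal_gen_sub; first exact: frob_power_ideal.
by move=> _ [u /IJ Ju <-]; exact: frob_power_mem.
Qed.

Lemma frob_power_sub J e : is_ideal J -> frob_power p J e `<=` J.
Proof.
move=> hJ; apply: ideal_gen_sub => // _ [u Ju <-]; apply: idealX => //.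
by rewrite expn_gt0 (pchar_gt0 charR).
Qed.

Lemma frob_power_comp J d e :
  frob_power p (frob_power p J d) e = frob_power p J (d + e).
Proof.
have q0 : (0 < p ^ e)%N by rewrite expn_gt0 (pchar_gt0 charR).
apply/seteqP; split; last first.
  apply: ideal_gen_sub; first exact: frob_power_ideal.
  move=> _ [u Ju <-]; rewrite expnD exprM; apply: frob_power_mem.
  exact: frob_power_mem.
apply: ideal_gen_sub; first exact: frob_power_ideal.
move=> _ [u Ju <-]; move: u Ju.
apply: (@ideal_gen_sub _ _ [set u | frob_power p J (d + e) (u ^+ (p ^ e))]).
  have hF := frob_power_ideal J (d + e).
  split=> [|a x y Fx Fy] /=; first by rewrite expr0n gtn_eqF //; exact: ideal0.
  by rewrite frobD // exprMn; exact: hF.2.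
by move=> _ [u Ju <-] /=; rewrite -exprM -expnD; exact: frob_power_mem.
Qed.

Lemma frob_powerP e (T : finType) phi g J x : @dual_basis R (p ^ e) T phi g 1 ->
  is_ideal J -> frob_power p J e x <-> forall t, J (phi t x).
Proof.
move=> [hphi E] hJ; split=> [Jx t|Jphi]; last first.
  have := E x; rewrite expr1n mul1r => ->.
  have hF := frob_power_ideal J e.
  refine (ideal_sum _ hF _) => t _; refine (ideal_mulr _ hF _).
  exact: frob_power_mem.
have [phiB phiZ] := hphi t.
(* [phi t] is linear only over p^e-th powers, so all multiples of x are tested to make C an
   ideal. *)
pose C := [set x | forall a, J (phi t (a * x))].
suff : C x by move=> /(_ 1); rewrite mul1r.
have phi0 : phi t 0 = 0 by rewrite -[X in phi t X](subrr 0) phiB subrr.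
have phiD u v : phi t (u + v) = phi t u + phi t v.
  by rewrite -{1}[v]opprK phiB -[- v]sub0r phiB phi0 sub0r opprK.
apply: Jx; split.
  split=> [a|b u v Cu Cv a]; first by rewrite mulr0 phi0; exact: ideal0.
  by rewrite mulrDr mulrA phiD; apply: idealD.
by move=> _ [u Ju <-] a; rewrite mulrC phiZ; exact: ideal_mulr.
Qed.

(* Flatness of Frobenius, as the compatibility of Frobenius powers with colons. *)
Lemma frob_power_colon J e a x : is_ideal J ->
  frob_power p J e (a ^+ (p ^ e) * x) -> frob_power p (colon J a) e x.
Proof.
move=> hJ; have [T [phi [g dual]]] := exists_dual_basis charR finR regR e.
move=> /(frob_powerP _ dual hJ) Jphi.
apply/(frob_powerP _ dual); first exact: colon_ideal.
by move=> t; rewrite /colon /= -(dual.1 t).2; exact: Jphi.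
Qed.

Definition principal_root (g : R) e := frob_root p (ideal_gen [set g]) e.

(** The root is generated by the coordinates of g: by [frob_powerP], g is in a Frobenius power of J
    exactly when J contains them. *)
Lemma principal_rootP g e :
  is_frob_root p (ideal_gen [set g]) e (principal_root g e).
Proof.
have [T [phi [h dual]]] := exists_dual_basis charR finR regR e.
apply: (@xgetPex _ set0 (is_frob_root p (ideal_gen [set g]) e)).
have hG := @ideal_gen_ideal _ [set phi t g | t in [set: T]].
exists (ideal_gen [set phi t g | t in [set: T]]); split=> //.
  apply: ideal_gen_sub; first exact: frob_power_ideal.
  move=> _ ->; apply/(frob_powerP _ dual) => // t.
  by apply: sub_ideal_gen; exists t.
move=> J hJ gJ; apply: ideal_gen_sub => // _ [t _ <-]; move: t.
by apply/(frob_powerP _ dual) => //; apply: gJ; exact: sub_ideal_gen.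
Qed.

Lemma principal_root_ideal g e : is_ideal (principal_root g e).
Proof. by case: (principal_rootP g e). Qed.

Lemma principal_root_sub g e J : is_ideal J ->
  principal_root g e `<=` J <-> frob_power p J e g.
Proof.
move=> hJ; have [hG gG min] := principal_rootP g e; split=> [GJ|Jg].
  by apply: (frob_powerS GJ); apply: gG; exact: sub_ideal_gen.
apply: min => //; apply: ideal_gen_sub; first exact: frob_power_ideal.
by move=> _ ->.
Qed.

Lemma principal_root_mem g e : frob_power p (principal_root g e) e g.
Proof. exact/(principal_root_sub _ _ (principal_root_ideal g e)). Qed.

Lemma principal_root_mul a g e : principal_root (a * g) e `<=` principal_root g e.
Proof.
apply/principal_root_sub; first exact: principal_root_ideal.
have hF := frob_power_ideal (principal_root g e) e.
by refine (ideal_mull a hF _); exact: principal_root_mem.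
Qed.

Lemma principal_root_exp f m n e : (m <= n)%N ->
  principal_root (f ^+ n) e `<=` principal_root (f ^+ m) e.
Proof. by move=> /subnK <-; rewrite exprD; exact: principal_root_mul. Qed.

(** For the harder inclusion, flatness puts 1 in a Frobenius power of the colon ideal of g, hence in
    that colon ideal. *)
Lemma principal_root_frob g d e :
  principal_root (g ^+ (p ^ d)) (e + d) = principal_root g e.
Proof.
apply/seteqP; split; apply/principal_root_sub; try exact: principal_root_ideal.
  by rewrite -frob_power_comp; apply: frob_power_mem; exact: principal_root_mem.
set J := principal_root _ _.
have hJe := frob_power_ideal J e.
have /(frob_power_colon hJe)/frob_power_sub :
    frob_power p (frob_power p J e) d (g ^+ (p ^ d) * 1).
  by rewrite mulr1 frob_power_comp; exact: principal_root_mem.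
by move=> /(_ (colon_ideal _ hJe)); rewrite /colon /= mulr1.
Qed.

(* The intersection [I] of the Frobenius powers of [b] satisfies
   [I = I^[p]] because each [phi t] maps [I] to itself. *)
Lemma frob_power_krull J f : is_ideal J -> f != 0 ->
  (forall n, frob_power p J n f) -> J 1.
Proof.
move=> hJ f0 Jf; apply: contrapT => J1.
have [M maxM JM] := ideal_sub_maximal regR.1 hJ J1.
have hM := maximal_prime maxM; have iM := prime_is_ideal hM.
pose I := [set x | forall n, frob_power p M n x].
have [T [phi [g dual]]] := exists_dual_basis charR finR regR 1.
have iI : is_ideal I.
  split=> [n|a x y Ix Iy n]; first exact: ideal0 (frob_power_ideal _ _).
  exact: (frob_power_ideal M n).2.
suff /(_ f) : I `<=` [set 0].
  move=> /(_ (fun n => frob_powerS JM (Jf n))) /= fE.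
  by rewrite fE eqxx in f0.
apply: (nakayama_ideal regR.1 hM) => //.
- by split=> // a x y -> ->; rewrite mulr0 addr0.
- move=> s u Ms /= /eqP; rewrite mulf_eq0 => /orP[/eqP s0|/eqP//].
  by case: Ms; rewrite s0; exact: ideal0.
move=> u Iu; exists 1; first by case: hM.
exists 0 => //; rewrite mul1r subr0.
have Iphi t : I (phi t u).
  move=> n; move: t; apply/(frob_powerP _ dual); first exact: frob_power_ideal.
  by rewrite frob_power_comp.
have Mphi t : M (phi t u).
  by have := Iphi t 0%N; exact: frob_power_sub.
have := dual.2 u; rewrite expr1n mul1r expn1 => {1}->.
have hG := @ideal_gen_ideal R.
refine (ideal_sum _ (hG _) _) => t _; refine (ideal_mulr _ (hG _) _).
(* As p >= 2, one factor of phi_t(u)^p serves as an element of M and the others stay in I: thus I is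
   inside M I. *)
rewrite -(prednK (pchar_gt0 charR)) exprS.
have [p1|p1] := posnP p.-1; last first.
  apply: sub_ideal_gen; exists (phi t u) => //; exists (phi t u ^+ p.-1) => //.
  by refine (idealX iI p1 _); exact: Iphi.
by have := prime_gt1 (pcharf_prime charR); rewrite -(prednK (pchar_gt0 charR)) p1.
Qed.

End FrobeniusRoots.

(** * Test ideals and jumping exponents *)

Section TestIdealTheory.
Variables (K : realType) (R : idomainType) (p : nat) (f : R).
Hypotheses (charR : p \in [pchar R]) (finR : F_finite p R) (regR : regular_ring R).
Implicit Types lam mu : K.

Local Notation tau := (@test_ideal R p K f).
Local Notation approx := (@test_ideal_approx R p K f).

Lemma q_gt0 e : 0 < (p ^ e)%:R :> K.
Proof. by rewrite ltr0n expn_gt0 (pchar_gt0 charR). Qed.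

Lemma absz_ceil_le (x : K) n : 0 <= x -> (`|Num.ceil x| <= n)%N = (x <= n%:R).
Proof.
move=> x0; have c0 : 0 <= Num.ceil x by rewrite -(ceil0 K) le_ceil.
by rewrite -lez_nat gez0_abs // ceil_le_int.
Qed.

Lemma absz_ceil_ge (x : K) : 0 <= x -> x <= `|Num.ceil x|%N%:R.
Proof. by move=> x0; rewrite -absz_ceil_le. Qed.

Lemma absz_ceil_nat n : `|Num.ceil (n%:R : K)|%N = n.
Proof.
apply/anti_leq; rewrite absz_ceil_le ?ler0n // lexx /=.
by rewrite -(ler_nat K) absz_ceil_ge ?ler0n.
Qed.

Lemma approxE lam e :
  approx lam e = principal_root p (f ^+ `|Num.ceil (lam * (p ^ e)%:R)|%N) e.
Proof. by []. Qed.

Lemma approx_antitone lam mu e : 0 <= lam -> lam <= mu -> approx mu e `<=` approx lam e.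
Proof.
move=> l0 lm; have q0 := q_gt0 e; apply: principal_root_exp => //.
rewrite absz_ceil_le ?mulr_ge0 ?(ltW q0) //.
apply: le_trans (absz_ceil_ge _); first by rewrite ler_pM2r.
by rewrite mulr_ge0 ?(ltW q0) // (le_trans l0).
Qed.

Lemma approx_monotone lam e : 0 <= lam -> approx lam e `<=` approx lam e.+1.
Proof.
move=> l0; rewrite !approxE.
rewrite -(principal_root_frob charR finR regR _ 1 e) addn1 -exprM.
apply: principal_root_exp => //; rewrite absz_ceil_le; last first.
  by rewrite mulr_ge0 // ltW ?q_gt0.
rewrite expn1 natrM expnSr natrM mulrA ler_pM2r ?ltr0n ?(pchar_gt0 charR) //.
by rewrite absz_ceil_ge // mulr_ge0 // ltW ?q_gt0.
Qed.

Lemma tau_stable lam : 0 <= lam ->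
  exists n, forall e, (n <= e)%N -> approx lam e = tau lam.
Proof.
move=> l0.
have [n hn] := noetherian_acc regR.1 (fun e => principal_root_ideal charR finR regR
  (f ^+ `|Num.ceil (lam * (p ^ e)%:R)|%N) e) (fun e => @approx_monotone lam e l0).
exists n => e ne; rewrite approxE hn //; apply/esym/xget_unique.
  by exists n => // m /= nm; exact: hn.
move=> J [m _ hm]; rewrite -(hm (maxn m n)) /= ?leq_maxl //.
by apply: hn; exact: leq_maxr.
Qed.

Lemma tau_antitone lam mu : 0 <= lam -> lam <= mu -> tau mu `<=` tau lam.
Proof.
move=> l0 lm; have [n hn] := tau_stable l0.
have [m hm] := tau_stable (le_trans l0 lm).
rewrite -(hm (maxn m n)) ?leq_maxl // -(hn (maxn m n)) ?leq_maxr //.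
exact: approx_antitone.
Qed.

Lemma tau_rat k e : tau (k%:R / (p ^ e)%:R) = principal_root p (f ^+ k) e.
Proof.
have l0 : 0 <= k%:R / (p ^ e)%:R :> K by rewrite divr_ge0 // ltW // q_gt0.
have [n hn] := tau_stable l0.
rewrite -(hn (e + n)%N) ?leq_addl // approxE expnD natrM mulrA divfK ?gt_eqF ?q_gt0 //.
by rewrite -natrM absz_ceil_nat exprM principal_root_frob.
Qed.

Hypothesis f_neq0 : f != 0.

(** The ideals J m increase, so they have a final value J. Then f^(k p^n) f is in the (e+n)-th
    Frobenius power of J for every n; by flatness f is in all Frobenius powers of (J^[q] : f^k), q =
    p^e. By [frob_power_krull] this colon ideal contains 1, that is, f^k is in J^[q]. *)
Lemma principal_root_right_continuous k e : exists m,
  principal_root p (f ^+ (k * p ^ m).+1) (e + m) = principal_root p (f ^+ k) e.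
Proof.
pose J m := principal_root p (f ^+ (k * p ^ m).+1) (e + m).
have hJ m : is_ideal (J m) by exact: principal_root_ideal.
have Jinc m : J m `<=` J m.+1.
  rewrite /J -(principal_root_frob charR finR regR _ 1 (e + m)) -addnA addn1 -exprM.
  apply: principal_root_exp => //.
  by rewrite mulSn expnSr expn1 mulnA -add1n leq_add2r (pchar_gt0 charR).
have [m hm] := noetherian_acc regR.1 hJ Jinc; exists m.
apply/seteqP; split.
  rewrite -[X in _ `<=` X](principal_root_frob charR finR regR _ m e) -exprM.
  by apply: principal_root_exp => //; exact: leqnSn.
rewrite -/(J m); apply/principal_root_sub => //.
have hF := frob_power_ideal p (J m) e.
have := @frob_power_krull R p charR finR regR (colon (frob_power p (J m) e) (f ^+ k)) f.
rewrite /colon /= mulr1; apply; first exact: colon_ideal.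
  exact: f_neq0.
move=> n; apply: frob_power_colon => //; rewrite frob_power_comp // -exprM -exprSr.
have JnJ : J n `<=` J m.
  have [nm|/ltnW mn] := leqP n m; last by rewrite hm.
  elim: m nm {hm hF} => [|m IHm]; first by rewrite leqn0 => /eqP->.
  rewrite leq_eqVlt ltnS => /orP[/eqP->//|/IHm h]; exact: subset_trans (Jinc _).
by apply: (frob_powerS JnJ); exact: principal_root_mem.
Qed.

Lemma tau_right_continuous lam : 0 <= lam ->
  exists2 eps, 0 < eps & tau (lam + eps) = tau lam.
Proof.
move=> l0; have [n hn] := tau_stable l0.
pose k := `|Num.ceil (lam * (p ^ n)%:R)|%N.
have [m hm] := principal_root_right_continuous k n.
pose mu : K := (k * p ^ m).+1%:R / (p ^ (n + m))%:R.
have lmu : lam < mu.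
  rewrite ltr_pdivlMr ?q_gt0 // expnD natrM mulrA.
  apply: (@le_lt_trans _ _ (k * p ^ m)%:R); last by rewrite ltr_nat.
  by rewrite natrM ler_pM2r ?q_gt0 // absz_ceil_ge // mulr_ge0 // ltW ?q_gt0.
exists (mu - lam); first by rewrite subr_gt0.
by rewrite addrC subrK tau_rat hm -(hn n).
Qed.

(** If tau differs at a and b, the infimum of the x in [a, b] with tau x = tau b is a jumping
    exponent: right continuity puts it in this set, so it is not a. *)
Lemma jumping_exponent_interval k e :
  (exists lam : K, F_jumping_exponent p f lam /\
     k%:R / (p ^ e)%:R < lam <= k.+1%:R / (p ^ e)%:R) <->
  principal_root p (f ^+ k) e <> principal_root p (f ^+ k.+1) e.
Proof.
rewrite -!tau_rat; set a := k%:R / _; set b := k.+1%:R / _.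
have a0 : 0 <= a by rewrite divr_ge0 // ltW // q_gt0.
have ab : a < b by rewrite ltr_pM2r ?invr_gt0 ?q_gt0 // ltr_nat.
have squeeze x y z : 0 <= x -> x <= y -> y <= z -> tau x = tau z -> tau x = tau y.
  move=> x0 xy yz E; apply/seteqP; split; last exact: tau_antitone.
  by rewrite E; apply: tau_antitone => //; exact: le_trans xy.
split=> [[lam [[l0 jump] /andP[al lb]]] E|neq].
  apply: (jump (lam - a)); rewrite ?subr_gt0 ?lerBlDr ?lerDl //.
  by rewrite opprB addrC subrK; apply/esym/(squeeze _ _ b) => //; exact: ltW.
pose S := [set x : K | a <= x <= b /\ tau x = tau b].
have Sb : S b by split; rewrite ?(ltW ab) ?lexx.
have Slb : has_lbound S by exists a => x [/andP[]].
pose lam := inf S.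
have al : a <= lam by apply: lb_le_inf; [exists b|move=> x [/andP[]]].
have lb : lam <= b by exact: ge_inf.
have l0 : 0 <= lam by exact: le_trans al.
have tl : tau lam = tau b.
  have [eps eps0 teps] := tau_right_continuous l0.
  have [|x [/andP[ax xb] tx] xl] := @inf_adherent _ S eps eps0.
    by split; [exists b|].
  rewrite -tx; apply: (squeeze _ _ (lam + eps)) => //; last exact: ltW.
  by apply: ge_inf => //; split=> //; rewrite ax.
have alt : a < lam.
  rewrite lt_neqAle al andbT; apply/eqP => E; apply: neq; rewrite -tl.
  by rewrite E.
exists lam; split; last by rewrite alt.
split; first exact: le_lt_trans alt.
move=> eps eps0 epsl E.
(* The maximum keeps the point in [a, b], where minimality of lam can be used. *)
have tm : tau (Num.max (lam - eps) a) = tau b.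
  have lt_max : Num.max (lam - eps) a <= lam.
    by rewrite ge_max al lerBlDr lerDl (ltW eps0).
  rewrite -tl E; apply/esym/(squeeze _ _ lam) => //; first by rewrite subr_ge0.
  by rewrite le_max lexx.
have : lam <= Num.max (lam - eps) a.
  apply: ge_inf => //; split=> //; rewrite le_max lexx orbT /= ge_max (ltW ab) andbT.
  by rewrite (le_trans _ lb) // lerBlDr lerDl ltW.
rewrite le_max [lam <= a]leNgt alt orbF.
by rewrite lerBrDr gerDl leNgt eps0.
Qed.

End TestIdealTheory.

(** * Differential operators *)

Section DifferentialOperators.
Variables (p e : nat).

Section Ring.
Variable A : comNzRingType.
Implicit Types (P Q : A -> A).
Local Notation diff_op := (@diff_op p e A).

Lemma diff_op0 P : diff_op P -> P 0 = 0.
Proof. by move=> [PB _]; have := PB 0 0; rewrite !subrr. Qed.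

Lemma diff_op_id : diff_op id.
Proof. by split. Qed.

Lemma diff_opB P Q : diff_op P -> diff_op Q -> diff_op (P \- Q).
Proof.
move=> [PB PM] [QB QM]; split=> [x y|a x] /=; first by rewrite PB QB; ring.
by rewrite PM QM mulrBr.
Qed.

Lemma diff_op_comp P Q : diff_op P -> diff_op Q -> diff_op (P \o Q).
Proof.
by move=> [PB PM] [QB QM]; split=> [x y|a x] /=; rewrite ?QB ?PB ?QM ?PM.
Qed.

Lemma diff_op_mul a : diff_op ( *%R a).
Proof. by split=> [x y|b x]; [rewrite mulrBr|rewrite mulrCA]. Qed.

Definition diff_orbit g : set A := [set x | exists2 P, diff_op P & x = P g].

Lemma diff_orbit_diff_op P g x : diff_op P -> diff_orbit g x -> diff_orbit g (P x).
Proof.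
by move=> hP [Q hQ ->]; exists (P \o Q) => //; exact: diff_op_comp.
Qed.

Lemma diff_orbit0 g : diff_orbit g 0.
Proof. by exists ( *%R 0); [exact: diff_op_mul|rewrite mul0r]. Qed.

Lemma diff_orbit_mull g a x : diff_orbit g x -> diff_orbit g (a * x).
Proof. by apply: diff_orbit_diff_op; exact: diff_op_mul. Qed.

Lemma diff_orbit1 x : diff_orbit 1 x.
Proof. by exists ( *%R x); [exact: diff_op_mul|rewrite mulr1]. Qed.

Lemma diff_orbit_exp g x : diff_orbit (g ^+ (p ^ e)) x <-> exists a, x = g ^+ (p ^ e) * a.
Proof.
split=> [[P hP ->]|[a ->]].
  by exists (P 1); rewrite -hP.2 mulr1.
by exists ( *%R a); [exact: diff_op_mul|rewrite mulrC].
Qed.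

End Ring.

(** Operators are linear over p^e-th powers, so they preserve Frobenius powers of ideals. Conversely
    x -> phi_t(x)^(p^e) is itself an operator, so the orbit contains the p^e-th powers of the
    coordinates of g. *)
Lemma diff_orbit_frob_power (R : idomainType) (g : R) : p \in [pchar R] ->
  F_finite p R -> regular_ring R ->
  @diff_orbit R g = frob_power p (principal_root p g e) e.
Proof.
move=> charR finR regR; set J := principal_root p g e.
have hJ : is_ideal J by exact: principal_root_ideal.
have hF := frob_power_ideal p J e.
have [T [phi [h dual]]] := exists_dual_basis charR finR regR e.
apply/seteqP; split=> [_ [P hP ->]|].
  pose C : set R := [set x | forall a, frob_power p J e (P (a * x))].
  suff : C g by move=> /(_ 1); rewrite mul1r.
  have Jg : frob_power p J e g by exact: principal_root_mem.
  have P0 := diff_op0 hP.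
  have PD u v : P (u + v) = P u + P v.
    by rewrite -{1}[v]opprK hP.1 -[- v]sub0r hP.1 P0 sub0r opprK.
  apply: Jg; split.
    split=> [a|b x y Cx Cy a]; first by rewrite mulr0 P0; exact: ideal0.
    rewrite mulrDr mulrA PD; refine (idealD hF _ _); [exact: Cx|exact: Cy].
  move=> _ [u Ju <-] a; rewrite mulrC hP.2; refine (ideal_mulr _ hF _).
  exact: frob_power_mem.
have orb_ideal : is_ideal (@diff_orbit R g).
  split; first exact: diff_orbit0.
  move=> a _ _ [P hP ->] [Q hQ ->]; exists ((( *%R a) \o P) \- (( *%R (-1)) \o Q)).
    by apply: diff_opB; apply: diff_op_comp => //; exact: diff_op_mul.
  by rewrite /= mulN1r opprK.
apply: ideal_gen_sub => // _ [u Ju <-].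
have : J `<=` [set u | diff_orbit g (u ^+ (p ^ e))].
  apply/principal_root_sub => //.
    split=> [|a x y Ix Iy] /=.
      by rewrite expr0n gtn_eqF ?expn_gt0 ?(pchar_gt0 charR) //; exact: diff_orbit0.
    by rewrite frobD // exprMn; exact: orb_ideal.2.
  have gE : g = \sum_t phi t g ^+ (p ^ e) * h t.
    by have := dual.2 g; rewrite expr1n mul1r.
  rewrite [X in frob_power _ _ _ X]gE.
  have hG := frob_power_ideal p [set u | diff_orbit g (u ^+ (p ^ e))] e.
  refine (ideal_sum _ hG _) => t _; refine (ideal_mulr _ hG _).
  apply: frob_power_mem => /=.
  exists (fun x => phi t x ^+ (p ^ e)) => //.
  have [phiB phiZ] := dual.1 t; split=> [x y|a x]; first by rewrite phiB frobB.
  by rewrite phiZ exprMn.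
exact.
Qed.

End DifferentialOperators.

(** A case of Lucas's theorem, by comparing coefficients in (X+1)^n = (X^(p^l) + 1) (X+1)^(n -
    p^l). *)
Lemma bin_pexp (A : comNzRingType) p n l : p \in [pchar A] ->
  'C(n, p ^ l)%:R = (n %/ p ^ l)%:R :> A.
Proof.
move=> charA; have P0 : (0 < p ^ l)%N by rewrite expn_gt0 (pchar_gt0 charA).
have coef_exp m i : (('X + 1) ^+ m : {poly A})`_i = 'C(m, i)%:R.
  elim: m i => [|m IHm] [|i]; rewrite ?expr0 ?exprS ?coef1 //.
    by rewrite mulrDl mul1r coefD coefXM /= add0r IHm !bin0.
  by rewrite mulrDl mul1r coefD coefXM /= !IHm binS natrD addrC.
have charAX : p \in [pchar {poly A}] by rewrite pchar_poly.
elim/ltn_ind: n => n IHn; have [nP|Pn] := ltnP n (p ^ l).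
  by rewrite bin_small // divn_small.
rewrite -coef_exp -(subnKC Pn) exprD frobD // expr1n mulrDl mul1r coefD coefXnM ltnn.
rewrite subnn !coef_exp bin0 IHn ?ltn_subrL ?P0 ?(leq_trans P0) //.
by rewrite divnDl ?dvdnn // divnn P0 natrD.
Qed.

(** * The operators theta and the ring they generate with D_R^e *)

Section Theta.
Variables (R : idomainType) (p e : nat).
Hypothesis charR : p \in [pchar R].
Let charRX : p \in [pchar {poly R}]. Proof. by rewrite pchar_poly. Qed.
Let p0 : (0 < p)%N. Proof. exact: pchar_gt0 charR. Qed.

Lemma coef_theta l (h : {poly R}) j :
  (theta (p ^ l) h)`_j = (j %/ p ^ l).+1%:R * h`_j.
Proof.
rewrite /theta coef_nderivn coefXnM ltnNge leq_addr /= addKn.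
rewrite -[LHS]mulr_natl bin_pexp // divnDl ?dvdnn // divnn expn_gt0 p0 add1n //.
Qed.

Lemma coef_expM_poly (c : R) (h : {poly R}) n j : (c%:P ^+ n * h)`_j = c ^+ n * h`_j.
Proof. by rewrite -rmorphXn coefCM. Qed.

Lemma poly_diff_op (P : {poly R} -> {poly R}) : zmod_morphism P ->
  (forall c x, P (c%:P ^+ (p ^ e) * x) = c%:P ^+ (p ^ e) * P x) ->
  (forall x, P ('X^(p ^ e) * x) = 'X^(p ^ e) * P x) -> diff_op p e P.
Proof.
move=> PB PC PX; split=> // a.
have P0 : P 0 = 0 by have := PB 0 0; rewrite !subrr.
have PD u v : P (u + v) = P u + P v.
  by rewrite -{1}[v]opprK PB -[- v]sub0r PB P0 sub0r opprK.
elim/poly_ind: a => [|a c IHa] x.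
  by rewrite expr0n gtn_eqF ?expn_gt0 ?p0 // !mul0r P0.
by rewrite frobD // exprMn !mulrDl PD PC -!mulrA IHa PX.
Qed.

Lemma theta_diff_op l : (l < e)%N -> diff_op p e (@theta R (p ^ l)).
Proof.
move=> le; apply: poly_diff_op => [x y|c x|x].
- by apply/polyP => j; rewrite coefB !coef_theta coefB mulrBr.
- by apply/polyP => j; rewrite coef_expM_poly !coef_theta coef_expM_poly mulrCA.
apply/polyP => j; rewrite coef_theta !coefXnM coef_theta.
case: ltnP => [_|qj]; first by rewrite mulr0.
(* As l < e, shifting j by p^e changes the quotient by p^l by a multiple of p. *)
have qE : (p ^ e = p ^ (e - l.+1).+1 * p ^ l)%N by rewrite -expnD addSnnS subnK.
congr (_ * _); rewrite -{1}(subnKC qj) {1}qE divnMDl ?expn_gt0 ?p0 // -addnS natrD.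
by rewrite expnS natrM (pcharf0 charR) mul0r add0r.
Qed.

Lemma map_poly_diff_op P : diff_op p e P -> diff_op p e (map_poly P : {poly R} -> _).
Proof.
move=> hP; have P0 := diff_op0 hP; apply: poly_diff_op => [x y|c x|x].
- by apply/polyP => j; rewrite coefB !coef_map_id0 // coefB hP.1.
- by apply/polyP => j; rewrite coef_expM_poly !coef_map_id0 // coef_expM_poly hP.2.
apply/polyP => j; rewrite coef_map_id0 // !coefXnM coef_map_id0 //.
by case: ltnP.
Qed.

Lemma DR_theta_coef Q : DR_theta p e Q -> diff_op p e Q /\
  exists P : nat -> R -> R, (forall j, diff_op p e (P j)) /\
    forall h j, (Q h)`_j = P j h`_j.
Proof.
move=> hQ; refine (hQ [set Q : {poly R} -> {poly R} | diff_op p e Q /\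
  exists P : nat -> R -> R, (forall j, diff_op p e (P j)) /\
    forall h j, (Q h)`_j = P j h`_j] _); split; first split.
- split; first exact: diff_op_id.
  by exists (fun=> id); split=> // j; exact: diff_op_id.
- move=> Q1 Q2 [h1 [P1 [hP1 E1]]] [h2 [P2 [hP2 E2]]]; split; first exact: diff_opB.
  exists (fun j => P1 j \- P2 j); split=> [j|h j]; first exact: diff_opB.
  by rewrite coefB E1 E2.
- move=> Q1 Q2 [h1 [P1 [hP1 E1]]] [h2 [P2 [hP2 E2]]]; split; first exact: diff_op_comp.
  exists (fun j => P1 j \o P2 j); split=> [j|h j]; first exact: diff_op_comp.
  by rewrite /= E1 E2.
move=> _ [[P hP <-]|[l le <-]].
  split; first exact: map_poly_diff_op.
  by exists (fun=> P); split=> // h j; rewrite coef_map_id0 // (diff_op0 hP).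
split; first exact: theta_diff_op.
exists (fun j => *%R (j %/ p ^ l).+1%:R); split=> [j|h j]; first exact: diff_op_mul.
exact: coef_theta.
Qed.

(** A partial converse to [DR_theta_coef]: the closure properties below show that the ring contains
    the projections onto single powers t^j, j < p^e. *)
Definition acts_coefwise (P : nat -> R -> R) : Prop :=
  exists2 Q, DR_theta p e Q & forall h j, (Q h)`_j = P j h`_j.

Lemma DR_theta_subring : op_subring (@DR_theta p e R).
Proof.
split=> [S [[]] //|P Q hP hQ S hS|P Q hP hQ S hS].
- by case: (hS) => -[_ + _] _; apply; [exact: hP|exact: hQ].
- by case: (hS) => -[_ _ +] _; apply; [exact: hP|exact: hQ].
Qed.

Lemma acts_diff_op P : diff_op p e P -> acts_coefwise (fun=> P).
Proof.
move=> hP; exists (map_poly P); last by move=> h j; rewrite coef_map_id0 // (diff_op0 hP).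
by move=> S [_]; apply; left; exists P.
Qed.

Lemma acts_theta l : (l < e)%N -> acts_coefwise (fun j => *%R (j %/ p ^ l).+1%:R).
Proof.
move=> le; exists (theta (p ^ l)); last by move=> h j; rewrite coef_theta.
by move=> S [_]; apply; right; exists l.
Qed.

Lemma actsB P Q : acts_coefwise P -> acts_coefwise Q ->
  acts_coefwise (fun j => P j \- Q j).
Proof.
have [_ hB _] := DR_theta_subring.
move=> [P' hP EP] [Q' hQ EQ]; exists (P' \- Q'); first exact: hB.
by move=> h j; rewrite coefB EP EQ.
Qed.

Lemma acts_comp P Q : acts_coefwise P -> acts_coefwise Q ->
  acts_coefwise (fun j => P j \o Q j).
Proof.
have [_ _ hC] := DR_theta_subring.
move=> [P' hP EP] [Q' hQ EQ]; exists (P' \o Q'); first exact: hC.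
by move=> h j; rewrite /= EP EQ.
Qed.

Lemma acts_ext P Q : (forall j x, P j x = Q j x) -> acts_coefwise P -> acts_coefwise Q.
Proof. by move=> PQ [S hS ES]; exists S => // h j; rewrite ES PQ. Qed.

Lemma acts_sum (T : Type) (r : seq T) (P : T -> nat -> R -> R) :
  (forall t, acts_coefwise (P t)) ->
  acts_coefwise (fun j x => \sum_(t <- r) P t j x).
Proof.
move=> hP; have acts0 : acts_coefwise (fun _ _ => 0).
  apply: acts_ext (actsB (acts_diff_op (diff_op_id _ _ _)) (acts_diff_op (diff_op_id _ _ _))).
  by move=> j x /=; rewrite subrr.
elim: r => [|t r IHr]; first by apply: acts_ext acts0 => j x; rewrite big_nil.
apply: acts_ext (actsB (hP t) (actsB acts0 IHr)) => j x /=.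
by rewrite big_cons sub0r opprK.
Qed.

Definition acts_by (a : nat -> R) := acts_coefwise (fun j => *%R (a j)).

Lemma acts_by_const c : acts_by (fun=> c).
Proof. by apply: acts_diff_op; exact: diff_op_mul. Qed.

Lemma acts_byB a b : acts_by a -> acts_by b -> acts_by (fun j => a j - b j).
Proof.
by move=> ha hb; apply: acts_ext (actsB ha hb) => j x; rewrite /= mulrBl.
Qed.

Lemma acts_byM a b : acts_by a -> acts_by b -> acts_by (fun j => a j * b j).
Proof.
by move=> ha hb; apply: acts_ext (acts_comp ha hb) => j x; rewrite /= mulrA.
Qed.

Lemma acts_byX a n : acts_by a -> acts_by (fun j => a j ^+ n).
Proof.
move=> ha; elim: n => [|n IHn]; first exact: acts_by_const 1.
by apply: acts_ext (acts_byM ha IHn) => j x; rewrite exprS.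
Qed.

Lemma acts_by_prod (T : Type) (r : seq T) (a : T -> nat -> R) :
  (forall t, acts_by (a t)) -> acts_by (fun j => \prod_(t <- r) a t j).
Proof.
move=> ha; elim: r => [|t r IHr].
  by apply: acts_ext (acts_by_const 1) => j x; rewrite big_nil.
by apply: acts_ext (acts_byM (ha t) IHr) => j x; rewrite big_cons.
Qed.

(** Fermat in a domain: z = a - b satisfies z^p = z, so z^(p-1) is 1 unless z = 0. *)
Lemma expr_nat_pred (a b : nat) :
  1 - (a%:R - b%:R : R) ^+ p.-1 = (a == b %[mod p])%N%:R.
Proof.
set z : R := a%:R - b%:R.
have natX n : n%:R ^+ p = n%:R :> R.
  by rewrite -(pFrobenius_autE charR); exact: pFrobenius_aut_nat.
have z_frob : z ^+ p = z by rewrite /z (frobB1 charR) !natX.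
have modR n : (n %% p)%N%:R = n%:R :> R.
  by rewrite [in RHS](divn_eq n p) natrD natrM (pcharf0 charR) mulr0 add0r.
have p1 : (0 < p.-1)%N by have := prime_gt1 (pcharf_prime charR); case: (p) => [|[]].
have [z0|z0] := eqVneq z 0; last first.
  have -> : z ^+ p.-1 = 1 by apply: (mulfI z0); rewrite -exprS prednK // mulr1.
  rewrite subrr; case: eqP => // E; move: z0.
  by rewrite /z -(modR a) -(modR b) E subrr eqxx.
rewrite z0 expr0n gtn_eqF // subr0; suff -> : (a == b %[mod p])%N by [].
wlog ab : a b @z z_frob z0 / (b <= a)%N.
  move=> W; have [ba|/ltnW ab] := leqP b a; first by apply: W.
  rewrite eq_sym; apply: (W b a) => //; last by rewrite -opprB -/z z0 oppr0.
  by rewrite -opprB -/z z0 oppr0 expr0n gtn_eqF.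
rewrite eqn_mod_dvd // (dvdn_pcharf charR) natrB //.
by apply/eqP.
Qed.

End Theta.

(** * The module M_f^e *)

Section Digits.
Variable p : nat.
Hypothesis p_gt0 : (0 < p)%N.
Local Open Scope nat_scope.

Definition digit_sum e (c : 'I_e -> nat) := \sum_(l < e) c l * p ^ l.

Lemma digit_sumS e (c : 'I_e.+1 -> nat) :
  digit_sum c = digit_sum (fun l => c (lift ord0 l)) * p + c ord0.
Proof.
rewrite /digit_sum big_ord_recl expn0 muln1 addnC big_distrl; congr (_ + _).
by apply: eq_bigr => l _; rewrite /= /bump add1n expnSr mulnA.
Qed.

Lemma digit_sum_lt e (c : 'I_e -> nat) : (forall l, c l < p) -> digit_sum c < p ^ e.
Proof.
elim: e c => [|e IHe] c cp; first by rewrite /digit_sum big_ord0.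
have := IHe (fun l => c (lift ord0 l)) (fun l => cp _).
rewrite digit_sumS -(leq_pmul2r p_gt0) -expnSr; apply: leq_trans.
by rewrite mulSn addnC ltn_add2r.
Qed.

Lemma digit_sum_digit e (c : 'I_e -> nat) (l : 'I_e) : (forall l, c l < p) ->
  digit_sum c %/ p ^ l = c l %[mod p].
Proof.
elim: e c l => [|e IHe] c l cp; first by case: l.
rewrite digit_sumS; case: (unliftP ord0 l) => [l'|] ->.
  rewrite /= /bump add1n expnS divnMA divnMDl // (divn_small (cp _)) addn0.
  exact: (IHe (fun l => c (lift ord0 l))).
by rewrite /= expn0 divn1 modnMDl.
Qed.

Lemma eq_of_digits e a b : a < p ^ e -> b < p ^ e ->
  (forall l, l < e -> a %/ p ^ l = b %/ p ^ l %[mod p]) -> a = b.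
Proof.
elim: e a b => [|e IHe] a b; first by rewrite expn0 !ltnS !leqn0 => /eqP-> /eqP->.
rewrite expnSr -!ltn_divLR // => ha hb dig.
rewrite (divn_eq a p) (divn_eq b p); congr (_ * _ + _).
  by apply: IHe => // l le; rewrite -!divnMA -!expnS; exact: dig.
by have := dig 0 isT; rewrite expn0 !divn1.
Qed.

(** The first quotient equals p^(e-l) - 1 - floor(j/p^l), and p divides p^(e-l). *)
Lemma complement_digit e j l : j < p ^ e -> l < e ->
  p %| (p ^ e - j.+1) %/ p ^ l + (j %/ p ^ l).+1.
Proof.
move=> jq le; have P0 : 0 < p ^ l by rewrite expn_gt0 p_gt0.
have qE : p ^ e = p ^ (e - l) * p ^ l by rewrite -expnD subnK // ltnW.
set N := p ^ (e - l) in qE; set a := j %/ p ^ l; set b := j %% p ^ l.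
have aN : a < N by rewrite ltn_divLR // -qE.
have bP : b < p ^ l by rewrite ltn_mod.
have -> : p ^ e - j.+1 = (N - a.+1) * p ^ l + (p ^ l - b.+1).
  rewrite qE {1}(divn_eq j (p ^ l)) -/a -/b -addnS.
  have -> : N = (N - a.+1) + a.+1 by rewrite subnK.
  by rewrite addnK mulnDl mulSn; lia.
rewrite divnMDl // divn_small ?addn0; last by rewrite ltn_subrL P0.
by rewrite subnK // /N; apply: dvdn_exp => //; rewrite subn_gt0.
Qed.

End Digits.

(** * Graded description of M_f^e and of its eigenvectors *)

Section GammaSet.
Variables (R : idomainType) (p e : nat) (f : R).
Hypothesis charR : p \in [pchar R].
Let charRX : p \in [pchar {poly R}]. Proof. by rewrite pchar_poly. Qed.
Let p0 : (0 < p)%N. Proof. exact: pchar_gt0 charR. Qed.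
Local Notation q := (p ^ e)%N.
Let q0 : (0 < q)%N. Proof. by rewrite expn_gt0 p0. Qed.
Local Notation cls h := (Bcls f h q).

Lemma BclsB n h h' : Bcls f (h - h') n = Bcls f h n - Bcls f h' n.
Proof.
rewrite /Bcls -raddfB; congr (_ _).
by apply: loc_val_inj; rewrite loc_valB /= tofracB mulrBl.
Qed.

Lemma BclsD n h h' : Bcls f (h + h') n = Bcls f h n + Bcls f h' n.
Proof. by rewrite -[LHS](subrK (Bcls f h' n)) -BclsB addrK. Qed.

Lemma BclsMn n h m : Bcls f (h *+ m) n = Bcls f h n *+ m.
Proof.
elim: m => [|m IHm]; last by rewrite !mulrS BclsD IHm.
by rewrite !mulr0n -(subrr h) BclsB subrr.
Qed.

Lemma f_sub_t_exp : f_sub_t f ^+ q = (f ^+ q)%:P - 'X^q.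
Proof. by rewrite /f_sub_t frobB // rmorphXn. Qed.

Lemma size_f_sub_t_exp : size (f_sub_t f ^+ q) = q.+1.
Proof.
have g0 := expf_neq0 q (f_sub_t_neq0 f).
rewrite -size_poly_gt0 in g0; rewrite -(prednK g0) size_exp.
by rewrite /f_sub_t -opprB size_polyN size_XsubC mul1n.
Qed.

(** Equality of classes makes h - h' divisible by (f-t)^q, which has degree q. *)
Lemma Bcls_inj (h h' : {poly R}) : (size h <= q)%N -> (size h' <= q)%N -> cls h = cls h' -> h = h'.
Proof.
move=> sh sh' /Bcls_eq[r]; rewrite -mulrBl exprD mulrA.
move=> /(mulIf (expf_neq0 _ (f_sub_t_neq0 f))) E; apply: subr0_eq; rewrite E.
have [->|r0] := eqVneq r 0; first by rewrite mul0r.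
have := size_polyD h (- h'); rewrite E size_polyN size_mul ?expf_neq0 ?f_sub_t_neq0 //.
rewrite size_f_sub_t_exp addnS /=.
have : (0 < size r)%N by rewrite size_poly_gt0.
have : (maxn (size h) (size h') <= q)%N by rewrite geq_max sh.
move=> maxq size_r /leq_trans/(_ maxq).
by rewrite -{2}[q]add0n leq_add2r leqNgt size_r.
Qed.

Lemma f_sub_t_exp_pred : f_sub_t f ^+ q.-1 = \poly_(j < q) f ^+ (q.-1 - j).
Proof.
apply: (mulfI (f_sub_t_neq0 f)); rewrite -exprS prednK // f_sub_t_exp rmorphXn subrXX.
rewrite poly_def; congr (_ * _); apply: eq_bigr => j _.
by rewrite -rmorphXn mul_polyC.
Qed.

Lemma delta_cls : delta f = cls (f_sub_t f ^+ q.-1).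
Proof. by apply/Bcls_eq; exists 0; rewrite mul1r mul0r expr1 -exprSr prednK // subrr. Qed.

Lemma Bact_cls P h : diff_op p e P -> Bact p e P (cls h) = cls (P h).
Proof. by move=> hP; have := @BactE R f p e P h 1 p0 hP; rewrite mul1n. Qed.

(** [graded q.-1] is M_f^e and [graded q] is t M_f^e; for these n the subtraction n - j never
    truncates. *)
Definition graded (n : nat) : set (Bf f) := [set u | exists h : {poly R},
  [/\ (size h <= q)%N, forall j, (j < q)%N -> diff_orbit p e (f ^+ (n - j)) h`_j &
      u = cls h]].

Lemma graded_cls n (h : {poly R}) : (size h <= q)%N ->
  graded n (cls h) <-> forall j, (j < q)%N -> diff_orbit p e (f ^+ (n - j)) h`_j.
Proof.
move=> sh; split=> [[h' [sh' orb /Bcls_inj -> //]]|orb].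
by exists h; split.
Qed.

(** The projection onto t^j: the l-th factor is 1 or 0 according to whether i and j have the same
    l-th digit. *)
Lemma acts_component j : (j < q)%N ->
  acts_by p e (fun i => \prod_(l < e) (1 - ((i %/ p ^ l).+1%:R - (j %/ p ^ l).+1%:R : R) ^+ p.-1)).
Proof.
move=> jq; apply: acts_by_prod => l.
apply: acts_byB; first exact: acts_by_const.
apply: acts_byX; apply: acts_byB; last exact: acts_by_const.
exact: acts_theta.
Qed.

Lemma component_eq i j : (i < q)%N -> (j < q)%N ->
  \prod_(l < e) (1 - ((i %/ p ^ l).+1%:R - (j %/ p ^ l).+1%:R : R) ^+ p.-1) = (i == j)%:R.
Proof.
move=> iq jq; have [->|ij] := eqVneq i j.
  by rewrite big1 // => l _; rewrite expr_nat_pred // eqxx.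
have [l nl] : exists l : 'I_e, (i %/ p ^ l != j %/ p ^ l %[mod p])%N.
  apply: contrapT => /forallNP h; move/eqP: ij; apply.
  apply: (eq_of_digits p0 iq jq) => l le; apply/eqP.
  by have /negP := h (Ordinal le); rewrite negbK.
rewrite (bigD1 l) //= expr_nat_pred // -[(i %/ _).+1]addn1 -[(j %/ _).+1]addn1.
by rewrite eqn_modDr (negPf nl) mul0r.
Qed.

Lemma Mf_graded : @Mf R f p e = graded q.-1.
Proof.
have coefg j : (j < q)%N -> (f_sub_t f ^+ q.-1)`_j = f ^+ (q.-1 - j).
  by move=> jq; rewrite f_sub_t_exp_pred coef_poly jq.
have coefg0 j : (q <= j)%N -> (f_sub_t f ^+ q.-1)`_j = 0.
  by move=> qj; rewrite f_sub_t_exp_pred coef_poly ltnNge qj.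
apply/seteqP; split=> [_ [Q hQ <-]|u [h [sh orb ->]]].
  have [dQ [P [hP EP]]] := DR_theta_coef charR hQ.
  rewrite delta_cls Bact_cls //; apply/graded_cls => [|j jq].
    apply/leq_sizeP => j qj; rewrite EP coefg0 //; exact: diff_op0.
  by rewrite EP coefg //; exists (P j).
have /choice[P hP] : forall j, exists P, diff_op p e P /\
    ((j < q)%N -> h`_j = P (f ^+ (q.-1 - j))).
  move=> j; have [jq|qj] := ltnP j q; last by exists id; split=> //; exact: diff_op_id.
  by have [P hP E] := orb j jq; exists P.
(* Q extracts each coefficient f^(q-1-j) of [delta] and applies its own operator P j there. *)
have [Q hQ EQ] : acts_coefwise p e (fun i x => \sum_(j < q) P j
    (\prod_(l < e) (1 - ((i %/ p ^ l).+1%:R - (j %/ p ^ l).+1%:R) ^+ p.-1) * x)).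
  apply: acts_sum => j; apply: (@acts_comp R p e (fun=> P j)).
    by apply: acts_diff_op; case: (hP j).
  exact: acts_component.
have [dQ [P' [hP' EP']]] := DR_theta_coef charR hQ.
exists Q => //; rewrite delta_cls Bact_cls //; congr (Bcls _ _ _).
apply/polyP => j; have [jq|qj] := ltnP j q; last first.
  by rewrite EP' coefg0 // (diff_op0 (hP' j)) nth_default // (leq_trans sh).
rewrite EQ (bigD1 (Ordinal jq)) //= component_eq // eqxx mul1r coefg //.
rewrite -(hP j).2 // big1 ?addr0 // => i ij.
rewrite component_eq // (_ : (j == i) = false) ?mul0r; first exact: diff_op0 (hP i).1.
by apply/negP => /eqP ji; move: ij; rewrite -val_eqE /= ji eqxx.
Qed.

Lemma tMf_graded : @tMf R f p e = graded q.
Proof.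
rewrite /tMf Mf_graded.
(* Since t^q = f^q - (f-t)^q, the top coefficient wraps around to degree 0 with a factor f^q. *)
pose shift (h : {poly R}) : {poly R} := \poly_(j < q)
  (if j is j'.+1 then h`_j' else f ^+ q * h`_q.-1).
have clsX (h : {poly R}) : (size h <= q)%N -> Bmul 'X (cls h) = cls (shift h).
  move=> sh; rewrite BmulE; apply/Bcls_eq; exists (- (h`_q.-1)%:P).
  rewrite -mulrBl exprD mulrA; congr (_ * _).
  rewrite f_sub_t_exp; apply/polyP => j.
  rewrite mulNr coefB coefN coefXM coefCM coefB coefC coefXn coef_poly.
  case: j => [|j] /=; first by rewrite q0 ltn_eqF // subr0 sub0r mulrC.
  rewrite sub0r; case: ltngtP => [jq|qj|jq].
  - by rewrite subrr oppr0 mulr0 oppr0.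
  - by rewrite subr0 oppr0 mulr0 oppr0 nth_default // (leq_trans sh).
  - by rewrite subr0 -jq /= mulrN1 opprK.
apply/seteqP; split=> [_ [u [h [sh orb ->]] <-]|u [h [sh orb ->]]].
  rewrite clsX //; apply/graded_cls => [|j jq]; first exact: size_poly.
  rewrite coef_poly jq; case: j jq => [|j] jq.
    by rewrite subn0; apply/diff_orbit_exp; exists h`_q.-1.
  have := orb j (ltnW jq); congr (diff_orbit _ _ (_ ^+ _) _); lia.
have [a h0] : exists a, h`_0 = f ^+ q * a.
  by apply/diff_orbit_exp; have := orb 0%N q0; rewrite subn0.
(* The inverse shift: the top coefficient a is free, as it lies in D_R^e . f^0 = R. *)
pose h' := \poly_(j < q) (if j == q.-1 then a else h`_j.+1).
have sh' : (size h' <= q)%N by exact: size_poly.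
exists (cls h').
  apply/graded_cls => // j jq; rewrite coef_poly jq; case: eqP => [->|jq1].
    by rewrite subnn expr0; exact: diff_orbit1.
  have jq' : (j.+1 < q)%N by lia.
  have := orb _ jq'; congr (diff_orbit _ _ (_ ^+ _) _); lia.
rewrite clsX //; congr (Bcls _ _ _); apply/polyP => j; rewrite coef_poly.
case: ltnP => [jq|qj]; last by rewrite nth_default // (leq_trans sh).
case: j jq => [|j] jq; first by rewrite coef_poly prednK // leqnn eqxx h0.
by rewrite coef_poly (ltnW jq) ifN //; apply/eqP; lia.
Qed.

(** On t^j the operator theta_(p^l) + i_l is the scalar floor(j/p^l) + 1 + i_l of F_p. By
    [complement_digit] these all vanish exactly when q-1-j has digits i_l, so only the summand with
    q-1-j = k can contribute. *)
Lemma in_Gamma i : i \in @Gamma R f p e <->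
  let k := digit_sum p (fun l => i l : nat) in
  ~ diff_orbit p e (f ^+ k) `<=` diff_orbit p e (f ^+ k.+1).
Proof.
rewrite inE /Gamma /= Mf_graded tMf_graded.
set k := digit_sum _ _.
have kq : (k < q)%N by apply: digit_sum_lt => // l; exact: ltn_ord.
have unit_mod n : ~~ (p %| n)%N -> exists a : R, a * n%:R = 1.
  rewrite (dvdn_pcharf charR) => n0; exists (n%:R ^+ (p - 2)).
  apply: (mulfI n0); rewrite mulr1 -exprSr -exprS.
  have -> : (p - 2).+2 = p by have := prime_gt1 (pcharf_prime charR); lia.
  by rewrite -(pFrobenius_autE charR); exact: pFrobenius_aut_nat.
have act_theta h (l : 'I_e) : Bact p e (theta (p ^ l)) (cls h) + cls h *+ i l =
    cls (theta (p ^ l) h + h *+ i l).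
  rewrite Bact_cls; last exact: theta_diff_op.
  by rewrite BclsD BclsMn.
have coef_act (h : {poly R}) (l : 'I_e) j :
    (theta (p ^ l) h + h *+ i l)`_j = ((j %/ p ^ l).+1 + i l)%:R * h`_j.
  by rewrite coefD coefMn (coef_theta charR) natrD mulrDl [X in _ = _ + X]mulr_natl.
have size_act (h : {poly R}) (l : 'I_e) : (size h <= q)%N -> (size (theta (p ^ l) h + h *+ i l)%R <= q)%N.
  move=> sh; apply/leq_sizeP => j qj.
  by rewrite coef_act nth_default ?mulr0 // (leq_trans sh).
split=> [[u [[h [sh orb ->]] nt act]] sub|nsub].
  apply: nt; apply/graded_cls => // j jq; apply: contrapT => nj.
  have jk : (q - j.+1)%N = k.
    apply: (@eq_of_digits p p0 e) => //; first by rewrite ltn_subrL q0.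
    move=> l le; apply/eqP.
    have ek := @digit_sum_digit p p0 e (fun l => i l : nat) (Ordinal le) (fun l => ltn_ord (i l)).
    rewrite ek /=; have pd := complement_digit p0 jq le.
    have : (p %| (j %/ p ^ l).+1 + i (Ordinal le))%N.
      (* A nonzero scalar of F_p is invertible and would put h_j in the summand of t M_f^e. *)
      apply: contrapT => /negP/unit_mod[m mE]; apply: nj.
      rewrite -[h`_j]mul1r -mE -mulrA; apply: diff_orbit_mull.
      have := act (Ordinal le); rewrite act_theta => /graded_cls.
      by move=> /(_ (size_act _ _ sh))/(_ j jq); rewrite coef_act.
    rewrite [X in (p %| X)%N]addnC => pi; move: pd.
    rewrite -(eqn_modDr (j %/ p ^ l).+1) /dvdn => /eqP->.
    by move: pi; rewrite /dvdn => /eqP->.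
  have := orb j jq; have -> : (q.-1 - j = k)%N by rewrite -jk; lia.
  move=> /sub; have -> : k.+1 = (q - j)%N by rewrite -jk; lia.
  exact: nj.
have [a oa na] : exists2 a, diff_orbit p e (f ^+ k) a & ~ diff_orbit p e (f ^+ k.+1) a.
  apply: contrapT => no; apply: nsub => a oa; apply: contrapT => na.
  by apply: no; exists a.
(* The eigenvector is a t^j at the complement j of k. *)
pose j := (q - k.+1)%N.
have jq : (j < q)%N by rewrite ltn_subrL q0.
have coef_h m : (a%:P * 'X^j)`_m = if m == j then a else 0.
  by rewrite coefCM coefXn; case: eqP => _; rewrite ?mulr1 ?mulr0.
have size_h : (size (a%:P * 'X^j)%R <= q)%N.
  by apply/leq_sizeP => m qm; rewrite coef_h gtn_eqF // (leq_trans jq).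
exists (cls (a%:P * 'X^j)); split.
- apply/graded_cls => // m mq; rewrite coef_h; case: eqP => [->|_]; last exact: diff_orbit0.
  by have -> : (q.-1 - j = k)%N by rewrite /j; lia.
- move=> /graded_cls-/(_ size_h j jq); rewrite coef_h eqxx.
  by have -> : (q - j = k.+1)%N by rewrite /j; lia.
move=> l; rewrite act_theta; apply/graded_cls; first exact: size_act.
move=> m mq; rewrite coef_act coef_h; case: eqP => [->|_]; last first.
  by rewrite mulr0; exact: diff_orbit0.
suff /eqP-> : ((j %/ p ^ l).+1 + i l)%:R == 0 :> R by rewrite mul0r; exact: diff_orbit0.
rewrite -(dvdn_pcharf charR).
have := complement_digit p0 jq (ltn_ord l).
have -> : (q - j.+1 = k)%N by rewrite /j; lia.
rewrite /dvdn -(modnDml (k %/ _)) (@digit_sum_digit p p0 e (fun l => i l : nat) l) => [|l'].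
  by rewrite modnDml addnC.
exact: ltn_ord.
Qed.

End GammaSet.

(** * Roots of the Bernstein-Sato polynomial *)

Section Roots.
Variables (p e : nat) (R : idomainType) (f : R).
Hypothesis charR : p \in [pchar R].
Let p0 : (0 < p)%N. Proof. exact: pchar_gt0 charR. Qed.
Implicit Types i : {ffun 'I_e -> 'I_p}.

Local Notation digits i := (digit_sum p (fun l : 'I_e => i l : nat)).

Lemma digits_inj (i j : {ffun 'I_e -> 'I_p}) : digits i = digits j -> i = j.
Proof.
move=> E; apply/ffunP => l; apply/val_inj.
have := digit_sum_digit p0 l (fun l => ltn_ord (i l)).
by rewrite E (digit_sum_digit p0 l (fun l => ltn_ord (j l))) !modn_small.
Qed.

Lemma digits_surj k : (k < p ^ e)%N -> exists i, digits i = k.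
Proof.
move=> kq; exists [ffun l : 'I_e => Ordinal (ltn_pmod (k %/ p ^ l) p0)].
apply: (eq_of_digits p0 _ kq) => [|l le].
  by apply: digit_sum_lt => // l; rewrite ffunE ltn_mod.
rewrite (digit_sum_digit p0 (Ordinal le)) => [|l']; last by rewrite ffunE ltn_mod.
by rewrite ffunE modn_mod.
Qed.

Lemma BS_root_value i :
  \sum_(l < e) (i l)%:R / (p ^ (e - l))%:R = (digits i)%:R / (p ^ e)%:R :> rat.
Proof.
rewrite /digit_sum natr_sum mulr_suml; apply: eq_bigr => l _.
have pn m : (p ^ m)%:R != 0 :> rat by rewrite pnatr_eq0 -lt0n expn_gt0 p0.
have -> : (p ^ e = p ^ (e - l) * p ^ l)%N by rewrite -expnD subnK // ltnW.
by rewrite !natrM -mulf_div divff // mulr1.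
Qed.

(** Distinct digit tuples give distinct roots, so the linear factors are pairwise distinct; [uniq s]
    is what yields simplicity. *)
Lemma BS_polyE : exists2 s : seq rat, uniq s &
  BS_poly f p e = \prod_(c <- s) ('X - c%:P) /\
  forall x, x \in s <-> exists2 i, i \in @Gamma R f p e & x = (digits i)%:R / (p ^ e)%:R.
Proof.
pose root_of i : rat := \sum_(l < e) (i l)%:R / (p ^ (e - l))%:R.
have root_inj : injective root_of.
  move=> i j; rewrite /root_of !BS_root_value.
  move=> /(mulIf _) E; apply: digits_inj; apply/eqP; rewrite -(eqr_nat rat); apply/eqP.
  by apply: E; rewrite invr_eq0 pnatr_eq0 -lt0n expn_gt0 p0.
exists [seq root_of i | i <- index_enum _ & i \in @Gamma R f p e].
  by rewrite map_inj_uniq // filter_uniq // index_enum_uniq.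
split; first by rewrite big_map big_filter.
move=> x; split=> [/mapP[i]|[i iG ->]].
  by rewrite mem_filter => /andP[iG _] ->; exists i => //; exact: BS_root_value.
apply/mapP; exists i; last by rewrite /root_of BS_root_value.
by rewrite mem_filter iG mem_index_enum.
Qed.

Lemma Gamma_jump i : F_finite p R -> regular_ring R ->
  i \in @Gamma R f p e <->
  principal_root p (f ^+ digits i) e <> principal_root p (f ^+ (digits i).+1) e.
Proof.
move=> finR regR; rewrite in_Gamma //= !diff_orbit_frob_power //.
set k := digits i; split=> [nsub E|neq sub]; first by apply: nsub; rewrite E.
apply: neq; apply/seteqP; split; last exact: principal_root_exp.
apply/principal_root_sub => //; first exact: principal_root_ideal.
by apply: sub; exact: principal_root_mem.
Qed.

End Roots.

Local Close Scope classical_set_scope.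

Theorem theorem6p7 (K : realType) (p : nat) (R : idomainType) (f : R) (e : nat)
    (charR : p \in [pchar R]) (finR : F_finite p R) (regR : regular_ring R)
    (f_neq0 : f != 0) (e_ge1 : (1 <= e)%N) :
  (forall x : rat, root (BS_poly f p e) x -> mup x (BS_poly f p e) = 1%N) /\
  (forall x : rat, root (BS_poly f p e) x <->
     exists lam : K,
       [/\ F_jumping_exponent p f lam, 0 < lam, lam <= 1 &
           x = (Num.ceil ((p ^ e)%:R * lam) - 1)%:~R / (p ^ e)%:R]).
Proof.
have [s uniq_s [-> s_roots]] := BS_polyE e f charR.
have qK : 0 < (p ^ e)%:R :> K := q_gt0 K charR e.
have qQ : (p ^ e)%:R != 0 :> rat.
  by rewrite pnatr_eq0 -lt0n expn_gt0 (pchar_gt0 charR).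
have predZ k : k.+1%:Z - 1 = k%:Z by rewrite intS addrAC subrr add0r.
split=> x; rewrite root_prod_XsubC.
  by move=> xs; rewrite mu_prod_XsubC count_uniq_mem // xs.
split=> [/s_roots[i iG xE]|[lam [jump l0 l1 xE]]].
  move/(Gamma_jump f charR i finR regR): iG => /(jumping_exponent_interval K charR finR regR f_neq0).
  set k := digit_sum _ _ in xE *.
  move=> [lam [jump /andP[kl lk]]]; have l0 := jump.1.
  exists lam; split=> //.
    apply: (le_trans lk); rewrite ler_pdivrMr // mul1r ler_nat.
    by apply: digit_sum_lt; [exact: pchar_gt0 charR|move=> l; exact: ltn_ord].
  rewrite xE; congr (_ / _).
  suff -> : Num.ceil ((p ^ e)%:R * lam) = k.+1%:Z by rewrite predZ.
  apply: ceil_def; rewrite mulrC predZ.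
  by move: kl lk; rewrite ltr_pdivrMr // ler_pdivlMr // => -> ->.
set c := Num.ceil _ in xE; have c_gt0 : 0 < c by rewrite ceil_gt0 mulr_gt0.
(* k = c - 1 indexes the interval (k/q, (k+1)/q] containing lam, with q = p^e; lam <= 1 will give k
   < q, so k has e digits. *)
have [k cE] : exists k, c = k.+1%:Z.
  by case: (c) c_gt0 => [[|k]|] // _; exists k.
have /andP[cl lc] : (c - 1)%:~R < (p ^ e)%:R * lam <= c%:~R := ceil_itv _.
move: xE cl lc; rewrite cE predZ [_ * lam]mulrC -ltr_pdivrMr // -ler_pdivlMr // => xE kl lk.
have kq : (k < p ^ e)%N.
  by rewrite -lez_nat -cE ceil_le_int -[leRHS]mulr1 ler_pM2l.
have [i ik] := digits_surj charR kq.
apply/s_roots; exists i; last by rewrite ik.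
apply/(Gamma_jump f charR i finR regR); rewrite ik.
apply/(jumping_exponent_interval K charR finR regR f_neq0).
by exists lam; rewrite kl lk.
Qed.
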